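(* For a prime $p\ge5$, the $S_p\times C_2$-lattice $J_{X_p}\otimes\mathbb{Z}^-_{S_p}$ is $S_p\times C_2$-quasi-invertible but not $S_p\times C_2$-quasi-permutation. The $A_5\times C_2$-lattice $J_{X_5}\otimes\mathbb{Z}^-_{A_5}$ is $A_5\times C_2$-quasi-permutation.
   Context: For a finite group $G$, a $G$-lattice is a finitely generated $\mathbb{Z}$-free $\mathbb{Z}[G]$-module; a permutation lattice is one with a $\mathbb{Z}$-basis permuted by $G$; an invertible lattice is a direct summand of a permutation lattice. A $G$-lattice $M$ is quasi-permutation (resp. quasi-invertible) if there is an exact sequence of $G$-lattices $0\to M\to P\to Q\to0$ with $P$ permutation and $Q$ permutation (resp. invertible). $X_p$ is the natural $S_p$-set of size $p$, regarded as an $S_p\times C_2$-set with $C_2$ acting trivially (and restricted to $A_5\times C_2$ when $p=5$); $J_X=\mathbb{Z}[X]/\mathbb{Z}(\sum_{x\in X}x)$ for a finite $G$-set $X$. For an index $2$ subgroup $N$ of $G$, $\mathbb{Z}^-_N$ is the rank one $G$-lattice on which $g$ acts by $+1$ if $g\in N$ and by $-1$ otherwise. Tensor products are over $\mathbb{Z}$ with diagonal action. *)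

(* Defs.v *)
From HB Require Import structures.
From mathcomp Require Import all_boot all_order all_algebra.
From mathcomp Require Import all_fingroup all_solvable.
From mathcomp Require Import generic_quotient ring_quotient.
From mathcomp Require Import freeg.
From mathcomp Require Import boolp.

Set Implicit Arguments.
Unset Strict Implicit.
Unset Printing Implicit Defensive.

Import GRing.Theory.
Local Open Scope ring_scope.
Local Open Scope quotient_scope.

Definition Zbasis (M : zmodType) (I : finType) (b : I -> M) : Prop :=
  forall u : M, exists! c : {ffun I -> int}, u = \sum_i b i *~ c i.

Lemma Zbasis_crit (M : zmodType) (I : finType) (b : I -> M)
    (co : I -> M -> int) :
  (forall i, {morph co i : u v / u + v}) ->
  (forall i j, co i (b j) = (i == j)%:R) ->
  (forall u, exists c : I -> int, u = \sum_i b i *~ c i) ->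
  Zbasis b.
Proof.
move=> coD cob span u; have [c uE] := span u.
have co0 i : co i 0 = 0 by apply: (addrI (co i 0)); rewrite -coD !addr0.
have coZ i v (n : int) : co i (v *~ n) = co i v * n.
  have coN w : co i (- w) = - co i w.
    by apply: (addrI (co i w)); rewrite -coD !subrr co0.
  have con w (k : nat) : co i (w *+ k) = co i w *+ k.
    by elim: k => [|k IH]; rewrite ?mulr0n ?co0 // !mulrS coD IH.
  case: n => n; first by rewrite -pmulrn con -mulr_natr natz.
  by rewrite NegzE mulrNz -pmulrn coN con mulrN -mulr_natr natz.
have coE i (d : I -> int) : co i (\sum_j b j *~ d j) = d i.
  rewrite (big_morph (co i) (coD i) (co0 i)) (bigD1 i) //= big1 => [|j ji].
    by rewrite coZ cob eqxx mul1r addr0.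
  by rewrite coZ cob eq_sym (negPf ji) mul0r.
exists [ffun i => c i]; split.
  by rewrite uE; apply: eq_bigr => i _; rewrite ffunE.
by move=> d ud; apply/ffunP => i; rewrite ffunE -(coE i c) -uE {1}ud coE.
Qed.

Lemma Zbasis_coord (M : zmodType) (I : finType) (b : I -> M) : Zbasis b ->
  {co : I -> M -> int | [/\ forall i, {morph co i : u v / u + v},
     forall i j, co i (b j) = (i == j)%:R
     & forall u, u = \sum_i b i *~ co i u]}.
Proof.
move=> bP; have ex u := bP u.
pose c u := sval (cid (ex u)).
have cE u : u = \sum_i b i *~ c u i by rewrite /c; case: cid => e [].
have cU u (d : {ffun I -> int}) : u = \sum_i b i *~ d i -> c u = d.
  by rewrite /c; case: cid => e [_ eU] /= ud; apply: eU.
exists (fun i u => c u i); split=> // [i u v|i j].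
  rewrite (cU (u + v) [ffun i => c u i + c v i]) ?ffunE //.
  rewrite {1}[u]cE {1}[v]cE -big_split; apply: eq_bigr => k _.
  by rewrite ffunE mulrzDr.
rewrite (cU (b j) [ffun i => (i == j)%:R]) ?ffunE //.
rewrite (bigD1 j) //= big1 => [|k kj]; first by rewrite ffunE eqxx addr0.
by rewrite ffunE (negPf kj).
Qed.

(* The lemmas act1 and actM of action.v require a finite carrier. *)

Section TotalActions.
Variables (gT : finGroupType) (T : Type) (to : {action gT &-> T}).

Lemma tactM x g h : to x (g * h)%g = to (to x g) h.
Proof. by case: to => a [_ aM] /=; rewrite aM ?inE. Qed.

Lemma tact_inj g : injective (to^~ g).
Proof. by case: to => a [aI _] /=; apply: aI. Qed.

Lemma tact1 x : to x 1%g = x.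
Proof. by apply: (@tact_inj 1%g); rewrite -tactM mulg1. Qed.

End TotalActions.

(* MathComp actions are right actions: lact M u (g * h) is
   lact M (lact M u g) h. The corresponding left Z[G]-module structure is
   g.u = lact M u g^-1; permutation bases, exactness, diagonal tensor products
   and signs are the same on both sides. *)
Record glattice (gT : finGroupType) := GLattice {
  lmod :> zmodType;
  lact : {action gT &-> lmod};
  lactD : forall g, {morph lact^~ g : u v / u + v};
  lfree : exists (I : finType) (b : I -> lmod), Zbasis b }.

Section Lattices.
Variable gT : finGroupType.
Implicit Types M N P Q : glattice gT.

Definition equivariant M N (f : M -> N) : Prop :=
  forall g u, f (lact M u g) = lact N (f u) g.

(* 0 -> M -f-> P -h-> Q -> 0 *)
Definition short_exact M P Q (f : {additive M -> P}) (h : {additive P -> Q}) :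
    Prop :=
  [/\ equivariant f, equivariant h, injective f,
      forall x, h x = 0 <-> exists u, x = f u
    & forall y, exists x, h x = y].

Definition permutation_lattice P : Prop :=
  exists (I : finType) (b : I -> P),
    Zbasis b /\ forall g i, exists j, lact P (b i) g = b j.

Definition direct_sum P M N (f : {additive M -> P}) (h : {additive N -> P}) :
    Prop :=
  [/\ equivariant f, equivariant h
    & forall x, exists! uv : M * N, x = f uv.1 + h uv.2].

Definition invertible_lattice M : Prop :=
  exists P N (f : {additive M -> P}) (h : {additive N -> P}),
    permutation_lattice P /\ direct_sum f h.

Definition quasi_permutation M : Prop :=
  exists P Q (f : {additive M -> P}) (h : {additive P -> Q}),
    [/\ permutation_lattice P, permutation_lattice Q & short_exact f h].

Definition quasi_invertible M : Prop :=
  exists P Q (f : {additive M -> P}) (h : {additive P -> Q}),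
    [/\ permutation_lattice P, invertible_lattice Q & short_exact f h].

End Lattices.

Section Zquot.
Variables (V : zmodType) (R : V -> Prop).

Definition Zspan : {pred V} := fun v => `[< forall S : V -> Prop,
  S 0 -> (forall u w, S u -> S w -> S (u - w)) -> (forall u, R u -> S u) ->
  S v >].

Lemma Zspan_closed : zmod_closed Zspan.
Proof.
split=> [|u v /asboolP uS /asboolP vS]; apply/asboolP=> // S S0 SB RS.
exact: SB (uS S S0 SB RS) (vS S S0 SB RS).
Qed.
HB.instance Definition _ := GRing.isZmodClosed.Build V Zspan Zspan_closed.

Definition Zquot : zmodType := {ideal_quot Zspan}.

Definition Zpi (v : V) : Zquot := \pi_{ideal_quot Zspan} v.

Lemma ZpiD : {morph Zpi : u v / u + v}.
Proof. by move=> u v; rewrite /Zpi !piE. Qed.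

Lemma ZpiB : {morph Zpi : u v / u - v}.
Proof. by move=> u v; rewrite /Zpi !piE. Qed.

HB.instance Definition _ := GRing.isZmodMorphism.Build V Zquot Zpi ZpiB.

Lemma Zpi_rel v : R v -> Zpi v = 0.
Proof.
move=> Rv; rewrite -[0](raddf0 Zpi); apply/eqmodP; rewrite /= Quotient.equivE.
by rewrite subr0; apply/asboolP => S _ _; apply.
Qed.

Lemma Zpi_surj (u : Zquot) : exists v, u = Zpi v.
Proof. by exists (repr u); rewrite /Zpi reprK. Qed.

Definition Zlift (W : zmodType) (f : V -> W) (u : Zquot) : W := f (repr u).

Lemma Zlift_pi (W : zmodType) (f : {additive V -> W}) :
  (forall v, R v -> f v = 0) -> forall v, Zlift f (Zpi v) = f v.
Proof.
move=> fR v; rewrite /Zlift /Zpi.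
have /eqP := reprK (\pi_{ideal_quot Zspan} v).
rewrite -Quotient.idealrBE => /asboolP /(_ (fun w => f w = 0)) H.
apply/eqP; rewrite -subr_eq0 -raddfB; apply/eqP/H => //; first exact: raddf0.
by move=> u w fu fw; rewrite raddfB fu fw subr0.
Qed.

End Zquot.

Section FreeExt.
Variables (K : choiceType) (W : zmodType).

Definition fgext (f : K -> W) : {freeg K / int} -> W :=
  @fglift int (zmodule W) K f.

Lemma fgextB f : {morph fgext f : u v / u - v}.
Proof. by move=> u v; exact: (@lift_is_additive int K (zmodule W) f u v). Qed.
HB.instance Definition _ f :=
  GRing.isZmodMorphism.Build {freeg K / int} W (fgext f) (fgextB f).

Lemma fgextU f x : fgext f << x >> = f x.
Proof. by rewrite /fgext liftU scale1r. Qed.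

Lemma freeg_sumZ (D : {freeg K / int}) :
  D = \sum_(x <- dom D) << x >> *~ coeff x D.
Proof.
rewrite -{1}[D]freeg_sumE; apply: eq_bigr => x _.
by rewrite freeg_mulz intz.
Qed.

Lemma freeg_additive_ext (f h : {additive {freeg K / int} -> W}) :
  (forall x, f << x >> = h << x >>) -> f =1 h.
Proof.
move=> fh D; rewrite [D]freeg_sumZ !raddf_sum; apply: eq_bigr => x _.
by rewrite !raddfMz fh.
Qed.

End FreeExt.

Section FreeAction.
Variables (gT : finGroupType) (K : choiceType) (to : {action gT &-> K}).

Definition fgact (D : {freeg K / int}) (g : gT) : {freeg K / int} :=
  fgext (fun x => << to x g >>) D.

Lemma fgactU x g : fgact << x >> g = << to x g >>.
Proof. exact: fgextU. Qed.

Lemma fgactB D E g : fgact (D - E) g = fgact D g - fgact E g.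
Proof. exact: fgextB. Qed.

Lemma fgact1 D : fgact D 1%g = D.
Proof.
apply: (@freeg_additive_ext _ _ (fgext (fun x => << to x 1%g >>)) idfun) => x.
by rewrite /= fgextU tact1.
Qed.

Lemma fgactM D g h : fgact D (g * h)%g = fgact (fgact D g) h.
Proof.
rewrite /fgact; set p := fgext (fun x => << to x g >>).
set q := fgext (fun x => << to x h >>).
apply: (@freeg_additive_ext _ _ (fgext _) (q \o p)) => x.
by rewrite /= /p /q !fgextU tactM.
Qed.

Variable R : {freeg K / int} -> Prop.
Hypothesis Rstable : forall g D, R D -> R (fgact D g).

Definition qact (u : Zquot R) (g : gT) : Zquot R :=
  Zlift (fun D => Zpi R (fgact D g)) u.

Lemma qact_pi D g : qact (Zpi R D) g = Zpi R (fgact D g).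
Proof.
exact: (@Zlift_pi _ R _ (Zpi R \o fgext (fun x => << to x g >>)))
  (fun v Rv => Zpi_rel (Rstable g Rv)) D.
Qed.

Lemma qact1 u : qact u 1%g = u.
Proof. by have [D ->] := Zpi_surj u; rewrite qact_pi fgact1. Qed.

Lemma qactM u g h : qact u (g * h)%g = qact (qact u g) h.
Proof. by have [D ->] := Zpi_surj u; rewrite !qact_pi fgactM. Qed.

Lemma qactD g : {morph qact^~ g : u v / u + v}.
Proof.
move=> u v; have [D ->] := Zpi_surj u; have [E ->] := Zpi_surj v.
by rewrite -ZpiD !qact_pi -ZpiD /fgact raddfD.
Qed.

Definition qaction : {action gT &-> Zquot R} := TotalAction qact1 qactM.

End FreeAction.

Section JLattice.
Variables (gT : finGroupType) (X : finType) (to : {action gT &-> X}).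

(* J_X is Z[X] modulo the subgroup generated by the sum of X. *)
Definition Jrel (D : {freeg X / int}) : Prop := D = \sum_(x : X) << x >>.

Lemma Jrel_stable g D : Jrel D -> Jrel (fgact to D g).
Proof.
move=> ->; rewrite /Jrel /fgact raddf_sum /=.
rewrite [RHS](reindex_inj (act_inj to g)) /=.
by apply: eq_bigr => x _; rewrite fgextU.
Qed.

Lemma freeg_sum_fin (D : {freeg X / int}) :
  D = \sum_(x : X) << x >> *~ coeff x D.
Proof.
apply/eqP/freeg_eqP => y; rewrite raddf_sum (bigD1 y) //= big1 => [|x xy].
  by rewrite raddfMz /= coeffU eqxx mulr1 intz addr0.
by rewrite raddfMz /= coeffU (negPf xy) mulr0 mul0rz.
Qed.

Lemma J_free : exists (I : finType) (b : I -> Zquot Jrel), Zbasis b.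
Proof.
have [x0 _|X0] := pickP (fun _ : X => true); last first.
  exists void, (of_void _); apply: (@Zbasis_crit _ _ _ (of_void _)) => //.
  move=> u; exists (of_void _); have [D ->] := Zpi_surj u.
  by rewrite [D]freeg_sum_fin !big1 ?raddf0 // => x; have := X0 x.
exists {x : X | x \in predC1 x0}, (fun x => Zpi Jrel << val x >>).
have coR x D : Jrel D -> coeff x D - coeff x0 D = 0.
  have coS y : coeff y (\sum_(z : X) << z >>) = 1 :> int.
    rewrite raddf_sum (bigD1 y) //= big1 => [|z zy].
      by rewrite coeffU eqxx mulr1 addr0.
    by rewrite coeffU (negPf zy) mulr0.
  by move=> ->; rewrite !coS subrr.
pose co x : {freeg X / int} -> int := coeff x \- coeff x0.
have coE x D : Zlift (co x) (Zpi Jrel D) = coeff x D - coeff x0 D.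
  by rewrite (@Zlift_pi _ _ _ (coeff x \- coeff x0)) // => v; apply: coR.
apply: (@Zbasis_crit _ _ _ (fun x => Zlift (co (val x)))).
- move=> x u v; have [D ->] := Zpi_surj u; have [E ->] := Zpi_surj v.
  by rewrite -ZpiD !coE !coeffD opprD addrACA.
- move=> x y; rewrite coE !coeffU !mul1r eq_sym (negPf (valP y : val y != x0)) subr0.
  by rewrite val_eqE.
move=> u; have [D ->] := Zpi_surj u.
exists (fun x => coeff (val x) D - coeff x0 D).
have := Zpi_rel (erefl : Jrel (\sum_x << x >>)).
rewrite (bigD1 x0) //= raddfD /= raddf_sum => /eqP; rewrite addr_eq0 => /eqP e0.
rewrite {1}[D]freeg_sum_fin raddf_sum (bigD1 x0) //= raddfMz /= e0 mulNrz.
rewrite mulrz_suml -sumrN -big_split /=.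
rewrite [RHS](_ : _ = \sum_(x in predC1 x0)
  Zpi Jrel << x >> *~ (coeff x D - coeff x0 D)); last by rewrite [RHS]big_sub.
apply: eq_bigr => x _.
by rewrite [Zpi Jrel (_ *~ _)]raddfMz /= addrC mulrzBr.
Qed.

Definition J_lattice : glattice gT :=
  GLattice (qactD Jrel_stable
    : forall g, {morph (qaction Jrel_stable)^~ g : u v / u + v})
    J_free.

End JLattice.

Section Tensor.
Variables (gT : finGroupType) (M N : glattice gT).

Definition pair_act (uv : M * N) (g : gT) : M * N :=
  (lact M uv.1 g, lact N uv.2 g).

Lemma pair_act1 uv : pair_act uv 1%g = uv.
Proof. by case: uv => u v; rewrite /pair_act !tact1. Qed.

Lemma pair_actM uv g h : pair_act uv (g * h)%g = pair_act (pair_act uv g) h.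
Proof. by rewrite /pair_act !tactM. Qed.

Definition pair_action : {action gT &-> M * N} :=
  TotalAction pair_act1 pair_actM.

(* The tensor product over Z is Z[M * N] modulo the biadditivity relations;
   compatibility with Z-scalars follows from these. *)
Inductive tensor_rel : {freeg (M * N) / int} -> Prop :=
| tensor_relDl u u' v :
    tensor_rel (<< (u + u', v) >> - << (u, v) >> - << (u', v) >>)
| tensor_relDr u v v' :
    tensor_rel (<< (u, v + v') >> - << (u, v) >> - << (u, v') >>).

Lemma tensor_rel_stable g D :
  tensor_rel D -> tensor_rel (fgact pair_action D g).
Proof.
case=> [u u' v|u v v']; rewrite !fgactB !fgactU /pair_action /pair_act /= lactD.
  exact: tensor_relDl.
exact: tensor_relDr.
Qed.

Definition tens (u : M) (v : N) : Zquot tensor_rel :=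
  Zpi tensor_rel << (u, v) >>.

Lemma tensDl u u' v : tens (u + u') v = tens u v + tens u' v.
Proof.
have := Zpi_rel (tensor_relDl u u' v); rewrite !ZpiB.
move/eqP; rewrite subr_eq0 subr_eq => /eqP e.
exact: etrans e (addrC _ _).
Qed.

Lemma tensDr u v v' : tens u (v + v') = tens u v + tens u v'.
Proof.
have := Zpi_rel (tensor_relDr u v v'); rewrite !ZpiB.
move/eqP; rewrite subr_eq0 subr_eq => /eqP e.
exact: etrans e (addrC _ _).
Qed.

Lemma tensBl v : {morph tens^~ v : u u' / u - u'}.
Proof.
by move=> u u'; apply/eqP; rewrite eq_sym subr_eq -tensDl subrK.
Qed.

Lemma tensBr u : {morph tens u : v v' / v - v'}.
Proof.
by move=> v v'; apply/eqP; rewrite eq_sym subr_eq -tensDr subrK.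
Qed.

Lemma tensor_free :
  exists (I : finType) (b : I -> Zquot tensor_rel), Zbasis b.
Proof.
have [I [b /Zbasis_coord [cb [cbD cbE bE]]]] := lfree M.
have [J [c /Zbasis_coord [cc [ccD ccE cE]]]] := lfree N.
exists (I * J)%type, (fun ij => tens (b ij.1) (c ij.2)).
pose co (ij : I * J) : {freeg (M * N) / int} -> int :=
  fgext (fun uv => cb ij.1 uv.1 * cc ij.2 uv.2).
have coE ij D : Zlift (co ij) (Zpi tensor_rel D) = co ij D.
  apply: Zlift_pi => _ [u u' v|u v v']; rewrite /co !raddfB /= !fgextU /=.
    by rewrite cbD mulrDl addrAC addrK subrr.
  by rewrite ccD mulrDr addrAC addrK subrr.
apply: (@Zbasis_crit _ _ _ (fun ij => Zlift (co ij))).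
- move=> ij u v; have [D ->] := Zpi_surj u; have [E ->] := Zpi_surj v.
  by rewrite -ZpiD !coE /co raddfD.
- move=> [i j] [i' j']; rewrite coE /co fgextU /= cbE ccE xpair_eqE.
  by do 2!case: eqP.
move=> u; have [D ->] := Zpi_surj u.
exists (fun ij => co ij D); rewrite [D in LHS]freeg_sumZ raddf_sum /=.
transitivity (\sum_(uv <- dom D) \sum_(ij : I * J)
   tens (b ij.1) (c ij.2) *~ (cb ij.1 uv.1 * cc ij.2 uv.2 * coeff uv D)).
  apply: eq_bigr => -[m n] _; rewrite raddfMz /= -[Zpi _ _]/(tens m n).
  pose tl v : {additive M -> Zquot tensor_rel} :=
    HB.pack (tens^~ v) (GRing.isZmodMorphism.Build _ _ (tens^~ v) (tensBl v)).
  pose tr w : {additive N -> Zquot tensor_rel} :=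
    HB.pack (tens w) (GRing.isZmodMorphism.Build _ _ (tens w) (tensBr w)).
  have tE : tens m n = \sum_i \sum_j tens (b i) (c j) *~ (cb i m * cc j n).
    rewrite {1}[m]bE -[LHS]/(tl n _) raddf_sum; apply: eq_bigr => i _.
    rewrite raddfMz /= {1}[n]cE -[tens _ _]/(tr (b i) _) raddf_sum mulrz_suml.
    by apply: eq_bigr => j _; rewrite raddfMz /= -mulrzA mulrC.
  rewrite tE pair_big /= mulrz_suml; apply: eq_bigr => ij _.
  by rewrite -mulrzA.
rewrite exchange_big; apply: eq_bigr => ij _ /=.
rewrite [D in co ij D]freeg_sumZ /co raddf_sum /= mulrz_sumr.
apply: eq_bigr => uv _; rewrite raddfMz /= fgextU; congr (_ *~ _).
by rewrite -mulrzr intz.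
Qed.

Definition tensor : glattice gT :=
  GLattice (qactD tensor_rel_stable
    : forall g, {morph (qaction tensor_rel_stable)^~ g : u v / u + v})
    tensor_free.

End Tensor.

Section SignLattice.
Variables (gT : finGroupType) (N : {group gT}).
Hypothesis iN : #|[set: gT] : N|%g = 2.

Definition sign_act (n : int) (g : gT) : int := if g \in N then n else - n.

Lemma sign_act1 n : sign_act n 1%g = n.
Proof. by rewrite /sign_act group1. Qed.

Lemma mem_index2 g h : g \notin N -> h \notin N -> (g * h)%g \in N.
Proof using iN.
move=> gN hN; suff /setP /(_ h) : (g^-1 *: N)%g = ~: N.
  by rewrite mem_lcoset invgK inE hN.
apply/eqP; rewrite eqEcard card_lcoset; apply/andP; split.
  apply/subsetP => x; rewrite mem_lcoset invgK inE => gx.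
  by apply: contra gN => xN; rewrite -(groupMr g xN).
rewrite cardsCs setCK -cardsT -(Lagrange (subsetT N)) iN.
by rewrite muln2 -addnn addnK.
Qed.

Lemma sign_actM n g h :
  sign_act n (g * h)%g = sign_act (sign_act n g) h.
Proof using iN.
rewrite /sign_act; case: (boolP (g \in N)) => gN.
  by rewrite groupMl.
case: (boolP (h \in N)) => hN; first by rewrite groupMr // (negPf gN).
by rewrite mem_index2 // opprK.
Qed.

Definition sign_action : {action gT &-> int} :=
  TotalAction sign_act1 sign_actM.

Lemma sign_actD g : {morph sign_action^~ g : m n / m + n}.
Proof. by move=> m n /=; rewrite /sign_act; case: ifP; rewrite ?opprD. Qed.

Lemma int_free : exists (I : finType) (b : I -> int), Zbasis b.
Proof.
exists unit, (fun=> 1); apply: (@Zbasis_crit _ _ _ (fun=> id)).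
- by [].
- by case; case.
- by move=> u; exists (fun=> u); rewrite (big_pred1 tt) ?intz //; case.
Qed.

Definition sign_lattice : glattice gT := GLattice sign_actD int_free.

End SignLattice.

Section TimesC2.
Variable K : finGroupType.

(* C_2 is the additive group 'Z_2. *)
Definition timesC2 : finGroupType := (K * 'Z_2)%type.

(* K, seen as the index 2 subgroup K * 1 *)
Definition leftfactor : {group timesC2} := setX_group [set: K] [1 'Z_2].

Lemma index_leftfactor : #|[set: timesC2] : leftfactor|%g = 2.
Proof.
rewrite -divgS ?subsetT //= cardsX cards1 muln1 !cardsT card_prod card_ord.
by rewrite mulKn // -cardsT cardG_gt0.
Qed.

Variables (X : finType) (to : {action K &-> X}).

Definition inflate_act (x : X) (g : timesC2) : X := to x g.1.

Lemma inflate_act1 x : inflate_act x 1%g = x.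
Proof. exact: tact1. Qed.

Lemma inflate_actM x g h :
  inflate_act x (g * h)%g = inflate_act (inflate_act x g) h.
Proof. exact: tactM. Qed.

Definition inflate : {action timesC2 &-> X} :=
  TotalAction inflate_act1 inflate_actM.

(* J_X (x) Z^-_K, where C_2 acts trivially on the K-set X *)
Definition J_sign : glattice timesC2 :=
  tensor (J_lattice inflate) (sign_lattice index_leftfactor).

End TimesC2.

Section SubPerm.
Variables (T : finType) (A : {group {perm T}}).

Definition subperm_act (x : T) (s : [subg A]) : T := sgval s x.

Lemma subperm_act1 x : subperm_act x 1%g = x.
Proof. exact: perm1. Qed.

Lemma subperm_actM x s t :
  subperm_act x (s * t)%g = subperm_act (subperm_act x s) t.
Proof. exact: permM. Qed.

Definition subperm_action : {action [subg A] &-> T} :=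
  TotalAction subperm_act1 subperm_actM.

End SubPerm.

(* Main.v *)
Require Import Defs.
From HB Require Import structures.
From mathcomp Require Import all_boot all_order all_algebra.
From mathcomp Require Import all_fingroup all_solvable.
From mathcomp Require Import freeg ring zify.

(** Let X be a K-set, G = K * C_2, and let J stand for J_X tensored with the
    sign lattice.  An element of J is a function a on X modulo the constants,
    and a |-> (a i - a j) embeds J in the permutation lattice Z[X * X] on which
    C_2 exchanges the two coordinates: the sign of J is the antisymmetry of
    a i - a j.  Let F be the cokernel of this embedding.

    The lattice J is quasi-invertible if the identity of F factors through a
    permutation lattice.  The integers n for which n * id_F factors in this way
    form an ideal (perm_factor_comb), and two natural families of
    factorizations give two elements of it.
    - A point o of X splits F over its stabilizer: in F each x is the sum of
      the (x_jk - x_jo - x_ok) (j, k) and of the (x_io + x_oi) R_i, where R_i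
      is the i-th row sum.  Summing over o gives #|X| (perm_factor_card).
    - A cyclic order w on X gives a circulation l_w (the sum of the
      coordinates along the edges of w) and the class v_w in F of the set of
      all pairs whose arc crosses a given cut; this class does not depend on
      the cut.  The endomorphism id_F - v_w l_w is explicitly a sum of terms
      (i, j) y_ij, where y_ij compares the edge (i, j) with the path along w
      from i to j.  Summing over a family W of cyclic orders gives #|W|
      (perm_factor_cycles).
    For K = S_p and W the class of a p-cycle, #|W| divides (p - 1)!, so the
    ideal contains 1.

    For the second claim, suppose that 0 -> J -> P -> Q -> 0 is exact with P
    and Q permutation lattices.  Let sigma be the p-cycle i |-> i + 1 and d the
    doubling i |-> 2 i, so that sigma d = d sigma^2.  As J has no nonzero
    element fixed by sigma, and H^1(<sigma>, P) = 0, Tate cohomology gives an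
    exact sequence 0 -> H^0(P) -> H^0(Q) -> H^1(J) -> 0 of F_p-spaces, in which
    H^1(J) is a line on which d^-1 acts as 2 and d as 1/2.  Now H^0 of a
    permutation lattice has the sigma-fixed points of the permuted basis as a
    basis, so the trace of an element normalizing <sigma> on it counts common
    fixed points, and is the same for an element and for its inverse
    (fixcount_eq).  By additivity of traces (trace_extension) 2 = 1/2 in F_p,
    that is p = 3.

    For A_5 one resolution can be written down.  Let C be the conjugacy class
    in A_5 of a 5-cycle (12 elements, inverted by C_2), S the set of the 6
    pentagons {c, c^-1}, and E the set of the 15 unordered pairs of points,
    repetitions allowed.  The embedding of J in Z[X * X] + Z[S] has rank 4 =
    25 + 6 - (12 + 15), and an explicit surjection onto Z[C] + Z[E] has it as
    kernel; a right inverse is equally explicit, and exactness is a finite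
    computation (check_right_inverse, check_left_inverse). *)

Set Implicit Arguments.
Unset Strict Implicit.
Unset Printing Implicit Defensive.

Import Order.TTheory GRing.Theory Num.Theory.
Local Open Scope ring_scope.

(** * Permutation lattices as lattices of functions *)

Lemma sum_indicator (R : pzSemiRingType) (T : finType) (F : T -> R) (y : T) :
  \sum_x (x == y)%:R * F x = F y.
Proof.
rewrite (bigD1 y) //= eqxx mul1r big1 ?addr0 // => x /negPf ->.
by rewrite mul0r.
Qed.

Section PermLattice.
Variables (gT : finGroupType) (I : finType) (to : {action gT &-> I}).

Definition permZ_act (x : {ffun I -> int}) (g : gT) : {ffun I -> int} :=
  [ffun i => x (to i g^-1)%g].

Lemma permZ_act1 x : permZ_act x 1%g = x.
Proof. by apply/ffunP => i; rewrite ffunE invg1 act1. Qed.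

Lemma permZ_actM x g h : permZ_act x (g * h)%g = permZ_act (permZ_act x g) h.
Proof. by apply/ffunP => i; rewrite !ffunE invMg actM. Qed.

Definition permZ_action : {action gT &-> {ffun I -> int}} :=
  TotalAction permZ_act1 permZ_actM.

Lemma permZ_actD g : {morph permZ_action^~ g : x y / x + y}.
Proof. by move=> x y; apply/ffunP => i; rewrite !ffunE. Qed.

Definition dirac (i : I) : {ffun I -> int} := [ffun j => (j == i)%:R].

Lemma ffun_mulrzE (x : {ffun I -> int}) n i : (x *~ n) i = x i * n.
Proof.
have nat_case (y : {ffun I -> int}) k : (y *+ k) i = y i *+ k.
  by elim: k => [|k IH]; rewrite ?mulr0n ?ffunE // !mulrS ffunE IH.
case: n => n; first by rewrite -pmulrn nat_case -mulr_natr natz.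
by rewrite NegzE mulrNz ffunE -pmulrn nat_case mulrN -mulr_natr natz.
Qed.

Lemma dirac_sum (x : {ffun I -> int}) : x = \sum_i dirac i *~ x i.
Proof.
apply/ffunP => j; rewrite sum_ffunE (bigD1 j) //= big1 => [|i ij].
  by rewrite ffun_mulrzE ffunE eqxx mul1r addr0.
by rewrite ffun_mulrzE ffunE eq_sym (negPf ij) mul0r.
Qed.

Lemma dirac_basis : Zbasis dirac.
Proof.
apply: (@Zbasis_crit _ _ _ (fun i (x : {ffun I -> int}) => x i)).
- by move=> i x y; rewrite ffunE.
- by move=> i j; rewrite ffunE.
- by move=> x; exists x; apply: dirac_sum.
Qed.

Definition permZ : glattice gT :=
  GLattice permZ_actD
    (ex_intro _ I (ex_intro _ dirac dirac_basis)
      : exists (I0 : finType) (b : I0 -> {ffun I -> int}), Zbasis b).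

Lemma permZ_lact (x : permZ) g i : lact permZ x g i = x (to i g^-1)%g.
Proof. by rewrite ffunE. Qed.

Lemma dirac_act i g : lact permZ (dirac i) g = dirac (to i g).
Proof.
apply/ffunP => j; rewrite permZ_lact !ffunE.
by rewrite (canF_eq (actKV to g)).
Qed.

Lemma permZ_permutation : permutation_lattice permZ.
Proof.
exists I, dirac; split; first exact: dirac_basis.
by move=> g i; exists (to i g); apply: dirac_act.
Qed.

End PermLattice.

(** * The lattice J_X tensored with the sign lattice *)

Section JSign.
Variables (K : finGroupType) (X : finType) (to : {action K &-> X}).
Local Notation G := (timesC2 K).
Local Notation J := (J_sign to).

Definition left_sign (g : G) : int := if g \in leftfactor K then 1 else -1.

Local Notation JX := (J_lattice (inflate to)).
Local Notation ZK := (sign_lattice (index_leftfactor K)).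

(** Every element of the tensor product has this form: the second factor has
    rank one.  All computations in J go through this parametrization by
    functions on X, whose kernel consists of the constants. *)
Definition mkJ (a : {ffun X -> int}) : J :=
  tens (Zpi (@Jrel X) (\sum_x << x >> *~ a x) : JX) (1 : ZK).

Lemma mkJB : {morph mkJ : a b / a - b}.
Proof.
move=> a b; rewrite /mkJ -tensBl; congr tens; apply: etrans (ZpiB _ _ _).
by congr Zpi; rewrite -sumrB; apply: eq_bigr => x _; rewrite !ffunE mulrzBr.
Qed.
HB.instance Definition _ := GRing.isZmodMorphism.Build {ffun X -> int} J mkJ mkJB.

Lemma mkJ_surj (u : J) : exists a, u = mkJ a.
Proof.
have [D ->] := Zpi_surj u; rewrite [D]freeg_sumZ raddf_sum /=.
suff H uv : exists a, Zpi (@tensor_rel _ JX ZK) << uv >> = mkJ a.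
  elim: (dom D) => [|uv s [a IH]]; first by exists 0; rewrite big_nil raddf0.
  have [b E] := H uv; exists (b *~ coeff uv D + a).
  by rewrite big_cons IH raddfD /= raddfMz /= E raddfMz.
case: uv => u1 n; have [E ->] := Zpi_surj u1.
exists ([ffun x => coeff x E] *~ n); rewrite raddfMz /= /mkJ.
have -> : \sum_x << x >> *~ [ffun x0 => coeff x0 E] x = E.
  by rewrite [RHS]freeg_sum_fin; apply: eq_bigr => x _; rewrite ffunE.
pose tr : {additive ZK -> J} := HB.pack (tens (Zpi (@Jrel X) E : JX))
  (GRing.isZmodMorphism.Build _ _ _ (tensBr (Zpi (@Jrel X) E : JX))).
by rewrite -[RHS]/(tr 1 *~ n) -raddfMz /= intz.
Qed.

(** The differences a i - a j of the coefficients do not see the relation that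
    the sum of X vanishes, so they descend first to J_X, then to the tensor
    product; this is what makes them usable to detect zero. *)
Definition freeg_diff (D : {freeg X / int}) : {ffun X * X -> int} :=
  [ffun ij => coeff ij.1 D - coeff ij.2 D].

Lemma freeg_diffB : {morph freeg_diff : D E / D - E}.
Proof.
move=> D E; apply/ffunP => ij; rewrite !ffunE !coeffB.
by rewrite !opprD !opprK addrACA.
Qed.
HB.instance Definition _ :=
  GRing.isZmodMorphism.Build {freeg X / int} {ffun X * X -> int} freeg_diff freeg_diffB.

Definition quot_diff : Zquot (@Jrel X) -> {ffun X * X -> int} := Zlift freeg_diff.

Lemma quot_diffE D : quot_diff (Zpi (@Jrel X) D) = freeg_diff D.
Proof.
apply: Zlift_pi => _ ->; rewrite raddf_sum; apply/ffunP => -[i j].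
have freeg_diffU x : freeg_diff << x >> (i, j) = (x == i)%:R - (x == j)%:R.
  by rewrite ffunE !coeffU !mul1r.
rewrite sum_ffunE ffunE; under eq_bigr do rewrite freeg_diffU.
rewrite sumrB (bigD1 i) //= eqxx big1 ?addr0 => [|x /negPf -> //].
by rewrite (bigD1 j) //= eqxx big1 ?addr0 ?subrr => [|x /negPf -> //].
Qed.

Lemma quot_diffD : {morph quot_diff : u v / u + v}.
Proof.
move=> u v; have [D ->] := Zpi_surj u; have [E ->] := Zpi_surj v.
by rewrite -ZpiD !quot_diffE raddfD.
Qed.

Definition tensor_diff : {freeg (JX * ZK) / int} -> {ffun X * X -> int} :=
  fgext (fun uv => quot_diff uv.1 *~ uv.2).

Definition jdiff : J -> {ffun X * X -> int} := Zlift tensor_diff.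

Lemma jdiff_pi D : jdiff (Zpi _ D) = tensor_diff D.
Proof.
apply: Zlift_pi => _ [u u' v|u v v']; rewrite /tensor_diff !raddfB /= !fgextU /=.
  by rewrite quot_diffD mulrzDl addrAC addrK subrr.
by rewrite mulrzDr addrAC addrK subrr.
Qed.

Lemma jdiffB : {morph jdiff : u v / u - v}.
Proof.
move=> u v; have [D ->] := Zpi_surj u; have [E ->] := Zpi_surj v.
by rewrite -ZpiB !jdiff_pi /tensor_diff raddfB.
Qed.
HB.instance Definition _ :=
  GRing.isZmodMorphism.Build J {ffun X * X -> int} jdiff jdiffB.

Lemma jdiff_mk a ij : jdiff (mkJ a) ij = a ij.1 - a ij.2.
Proof.
rewrite /mkJ jdiff_pi /tensor_diff fgextU /= quot_diffE mulr1z ffunE.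
suff cE i : coeff i (\sum_x << x >> *~ a x) = a i by rewrite !cE.
rewrite raddf_sum (bigD1 i) //= big1 => [|x xi].
  by rewrite raddfMz /= coeffU eqxx mul1r intz addr0.
by rewrite raddfMz /= coeffU (negPf xi) mulr0 mul0rz.
Qed.

Lemma mkJ_const n : mkJ [ffun=> n] = 0.
Proof.
rewrite /mkJ; under eq_bigr do rewrite ffunE.
rewrite -mulrz_suml raddfMz /= Zpi_rel // mul0rz.
by apply: (addrI (tens (0 : JX) (1 : ZK))); rewrite -tensDl !addr0.
Qed.

Lemma jdiff_inj : injective jdiff.
Proof.
apply: raddf_inj => u; have [a ->] := mkJ_surj u => /ffunP a0.
have [x0 _|X0] := pickP (fun _ : X => true); last first.
  by rewrite (_ : a = 0) ?raddf0 //; apply/ffunP => x; have := X0 x.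
rewrite -(mkJ_const (a x0)); congr mkJ; apply/ffunP => x; rewrite ffunE.
by have /eqP := a0 (x, x0); rewrite jdiff_mk ffunE subr_eq0 => /eqP.
Qed.

Lemma mkJ_act a g :
  lact J (mkJ a) g = mkJ (permZ_act (inflate to) a g *~ left_sign g).
Proof.
rewrite raddfMz /= /mkJ; pose D : {freeg X / int} := \sum_x << x >> *~ a x.
pose E : {freeg X / int} := \sum_x << x >> *~ permZ_act (inflate to) a g x.
apply: etrans (qact_pi (@tensor_rel_stable _ JX ZK) _ _) _.
have aE : lact JX (Zpi (@Jrel X) D) g = Zpi (@Jrel X) E.
  apply: etrans (qact_pi (@Jrel_stable _ _ _) _ _) _.
  congr Zpi; rewrite /fgact raddf_sum /= /E.
  rewrite [RHS](reindex_inj (act_inj (inflate to) g)); apply: eq_bigr => x _.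
  by rewrite raddfMz /= fgextU ffunE actK.
rewrite fgactU /= /pair_act [(_, _).1]/= aE.
pose tr : {additive ZK -> J} := HB.pack (tens (Zpi (@Jrel X) E : JX))
  (GRing.isZmodMorphism.Build _ _ _ (tensBr (Zpi (@Jrel X) E : JX))).
rewrite -[RHS]/(tr 1 *~ _) -raddfMz /= intz.
by rewrite /sign_act /left_sign.
Qed.

End JSign.

(** * Actions on finite sets, and the embedding of J in Z[X * X] *)

Section ProductAction.
Variables (gT : finGroupType) (S T : Type).
Variables (toS : {action gT &-> S}) (toT : {action gT &-> T}).

Definition prod_act (x : S * T) (g : gT) : S * T := (toS x.1 g, toT x.2 g).

Lemma prod_act1 x : prod_act x 1%g = x.
Proof. by case: x => s t; rewrite /prod_act !tact1. Qed.

Lemma prod_actM x g h : prod_act x (g * h)%g = prod_act (prod_act x g) h.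
Proof. by rewrite /prod_act !tactM. Qed.

Definition prod_action : {action gT &-> (S * T)%type} :=
  TotalAction prod_act1 prod_actM.

Definition sum_act (x : S + T) (g : gT) : S + T :=
  match x with inl s => inl (toS s g) | inr t => inr (toT t g) end.

Lemma sum_act1 x : sum_act x 1%g = x.
Proof. by case: x => s /=; rewrite tact1. Qed.

Lemma sum_actM x g h : sum_act x (g * h)%g = sum_act (sum_act x g) h.
Proof. by case: x => s /=; rewrite tactM. Qed.

Definition sum_action : {action gT &-> (S + T)%type} :=
  TotalAction sum_act1 sum_actM.

End ProductAction.

(** Every K * C_2-set below comes from a K-set by letting the generator of C_2
    act through a commuting involution. *)
Section Twist.
Variables (K : finGroupType) (T : Type) (a : {action K &-> T}) (iota : T -> T).
Hypothesis iotaK : involutive iota.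
Hypothesis iotaC : forall x k, iota (a x k) = a (iota x) k.

Definition twist_act (x : T) (g : timesC2 K) : T :=
  if g \in leftfactor K then a x g.1 else iota (a x g.1).

Lemma twist_act1 x : twist_act x 1%g = x.
Proof. by rewrite /twist_act group1 tact1. Qed.

Lemma twist_actM x g h :
  twist_act x (g * h)%g = twist_act (twist_act x g) h.
Proof.
rewrite /twist_act; have [gN|gN] := boolP (g \in _).
  by rewrite groupMl //= tactM.
have [hN|hN] := boolP (h \in _).
  by rewrite groupMr // (negPf gN) /= tactM -iotaC.
by rewrite (mem_index2 (index_leftfactor K)) //= tactM -iotaC iotaK.
Qed.

Definition twist : {action timesC2 K &-> T} := TotalAction twist_act1 twist_actM.

End Twist.

Section Swap.
Variables (K : finGroupType) (X : finType) (to : {action K &-> X}).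

Definition swap (x : X * X) := (x.2, x.1).

Lemma swapK : involutive swap. Proof. by case. Qed.

Lemma swapC x k : swap (prod_action to to x k) = prod_action to to (swap x) k.
Proof. by []. Qed.

Definition swap_action : {action timesC2 K &-> (X * X)%type} :=
  twist swapK swapC.

(** The sign by which C_2 acts on J becomes the exchange of coordinates, since
    a i - a j is antisymmetric. *)
Lemma jdiff_equivariant :
  @equivariant _ (J_sign to) (permZ swap_action) (@jdiff _ _ to).
Proof.
move=> g u; have [a ->] := mkJ_surj u; apply/ffunP => -[i j].
rewrite mkJ_act permZ_lact raddfMz /= raddfMz ffun_mulrzE !jdiff_mk /=.
rewrite /twist_act groupV /left_sign !ffunE /= /inflate_act.
by case: ifP => _ /=; rewrite ?mulr1 // mulrN1 opprB.
Qed.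

End Swap.

(** * Maps between permutation lattices given by matrices *)

Section MatrixMaps.
Variables (gT : finGroupType) (I L : finType).
Variables (toI : {action gT &-> I}) (toL : {action gT &-> L}).

Section Rows.
Variable A : L -> I -> int.

Definition rowsZ (x : {ffun I -> int}) : {ffun L -> int} :=
  [ffun l => \sum_i A l i * x i].

Lemma rowsZB : {morph rowsZ : x y / x - y}.
Proof.
move=> x y; apply/ffunP => l; rewrite !ffunE -sumrB.
by apply: eq_bigr => i _; rewrite !ffunE mulrBr.
Qed.
HB.instance Definition _ :=
  GRing.isZmodMorphism.Build {ffun I -> int} {ffun L -> int} rowsZ rowsZB.

Lemma rowsZ_equivariant :
    (forall l i g, A (toL l g) (toI i g) = A l i) ->
  @equivariant _ (permZ toI) (permZ toL) rowsZ.
Proof.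
move=> AG g x; apply/ffunP => l; rewrite permZ_lact !ffunE.
rewrite (reindex_inj (act_inj toI g)); apply: eq_bigr => i _ /=.
by rewrite ffunE actK -(AG _ i g) actKV.
Qed.

End Rows.

Section Columns.
Variable v : L -> {ffun I -> int}.

Definition colsZ (y : {ffun L -> int}) : {ffun I -> int} := \sum_l v l *~ y l.

Lemma colsZB : {morph colsZ : x y / x - y}.
Proof.
move=> x y; rewrite /colsZ -sumrB; apply: eq_bigr => l _.
by rewrite !ffunE mulrzBr.
Qed.
HB.instance Definition _ :=
  GRing.isZmodMorphism.Build {ffun L -> int} {ffun I -> int} colsZ colsZB.

(** The maps back to Z[I] considered below are equivariant only modulo the
    kernel of a map h. *)
Lemma colsZ_equivariant_mod (h : {additive permZ toI -> permZ toL}) :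
    (forall l g, h (v (toL l g)) = h (permZ_act toI (v l) g)) ->
  forall y g, h (colsZ (lact (permZ toL) y g)) = h (lact (permZ toI) (colsZ y) g).
Proof.
move=> hv y g; rewrite /colsZ.
have -> : lact (permZ toI) (\sum_l v l *~ y l) g = \sum_l permZ_act toI (v l) g *~ y l.
  apply/ffunP => i; rewrite permZ_lact !sum_ffunE; apply: eq_bigr => l _.
  by rewrite !ffun_mulrzE ffunE.
rewrite !raddf_sum (reindex_inj (act_inj toL g)); apply: eq_bigr => l _ /=.
by rewrite !raddfMz /= ffunE actK hv.
Qed.

End Columns.
End MatrixMaps.

(** * Fixed lattices of idempotents, and two criteria *)

Section Idempotent.
Variables (gT : finGroupType) (L : finType) (to : {action gT &-> L}).
Variable e : {additive {ffun L -> int} -> {ffun L -> int}}.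
Hypothesis eI : forall x, e (e x) = e x.
Hypothesis eG : forall x g, e (permZ_act to x g) = permZ_act to (e x) g.

Definition fixed_by : {pred {ffun L -> int}} := fun x => e x == x.

Lemma fixed_by_closed : zmod_closed fixed_by.
Proof.
split=> [|x y /eqP xe /eqP ye]; rewrite unfold_in ?raddf0 //.
by rewrite raddfB xe ye.
Qed.
HB.instance Definition _ :=
  GRing.isZmodClosed.Build {ffun L -> int} fixed_by fixed_by_closed.

Record fixed_space := FixedSpace {
  fval : {ffun L -> int}; fvalP : fval \in fixed_by }.
HB.instance Definition _ := [isSub for fval].
HB.instance Definition _ := [Choice of fixed_space by <:].
HB.instance Definition _ := [SubChoice_isSubZmodule of fixed_space by <:].

Lemma fvalK (u : fixed_space) : e (val u) = val u.
Proof. exact/eqP/(valP u). Qed.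

Lemma e_fixed x : e x \in fixed_by.
Proof. by rewrite unfold_in eI. Qed.

Definition fproj x : fixed_space := FixedSpace (e_fixed x).

Lemma fprojB : {morph fproj : x y / x - y}.
Proof. by move=> x y; apply: val_inj; rewrite /= raddfB. Qed.
HB.instance Definition _ :=
  GRing.isZmodMorphism.Build {ffun L -> int} fixed_space fproj fprojB.

Lemma permZ_act_fixed (u : fixed_space) g : permZ_act to (val u) g \in fixed_by.
Proof. by rewrite unfold_in eG fvalK. Qed.

Definition fixed_act u g : fixed_space := FixedSpace (permZ_act_fixed u g).

Lemma fixed_act1 u : fixed_act u 1%g = u.
Proof. by apply: val_inj; apply: permZ_act1. Qed.

Lemma fixed_actM u g h : fixed_act u (g * h)%g = fixed_act (fixed_act u g) h.
Proof. by apply: val_inj; apply: permZ_actM. Qed.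

Definition fixed_action : {action gT &-> fixed_space} :=
  TotalAction fixed_act1 fixed_actM.

Lemma fixed_actD g : {morph fixed_action^~ g : u v / u + v}.
Proof. by move=> u v; apply: val_inj; apply: (permZ_actD to g). Qed.

Let n := #|L|.
Let vec (x : {ffun L -> int}) : 'rV[int]_n := \row_k x (enum_val k).

(** Write the matrix M of e in Smith normal form A D B.  Since M is
    idempotent, D B A D = D; hence the rows of D B that belong to nonzero
    diagonal entries form a basis of the row space of M, and multiplication
    by A gives the coordinates in this basis. *)
Lemma fixed_free : exists (I : finType) (b : I -> fixed_space), Zbasis b.
Proof.
pose M : 'M[int]_n := \matrix_(k, l) e (dirac (enum_val k)) (enum_val l).
have vecM x : vec (e x) = vec x *m M.
  apply/rowP => l; rewrite !mxE [x in LHS]dirac_sum raddf_sum sum_ffunE.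
  rewrite (reindex _ (onW_bij _ (enum_val_bij L))) /=.
  by apply: eq_bigr => k _; rewrite raddfMz ffun_mulrzE !mxE mulrC.
have [A uA [B uB [d _ ME]]] := int_Smith_normal_form M.
set D := \matrix_(_, _) _ in ME.
have vec_inj x y : vec x = vec y -> x = y.
  move=> /rowP xy; apply/ffunP => l; have := xy (enum_rank l).
  by rewrite !mxE enum_rankK.
have vecB x y : vec (x - y) = vec x - vec y by apply/rowP=> k; rewrite !mxE !ffunE.
have [unvec vecK] : {g | cancel g vec}.
  exists (fun v => [ffun l => v 0 (enum_rank l)]) => v.
  by apply/rowP => k; rewrite mxE ffunE enum_valK.
have MM : M *m M = M.
  apply/row_matrixP => k; rewrite row_mul !rowE.
  by rewrite -(vecK (delta_mx 0 k)) -!vecM eI.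
have DAB : D *m B *m A *m D = D.
  apply: (can_inj (mulmxK uB)); apply: (can_inj (mulKmx uA)).
  by rewrite [A *m (D *m B)]mulmxA -ME -[in RHS]MM ME !mulmxA.
pose co (k : 'I_n) (u : fixed_space) := (vec (val u) *m A) 0 k.
have DE k l : D k l = d`_k *+ (k == l) by rewrite mxE.
pose b (k : 'I_n) : fixed_space := fproj (unvec (row k (invmx A))).
have bE k : vec (val (b k)) = row k (D *m B).
  by rewrite /= vecM vecK -row_mul ME !mulmxA mulVmx ?mul1mx.
exists {k : 'I_n | d`_k != 0}, (fun k => b (val k)).
apply: (@Zbasis_crit _ _ _ (fun k => co (val k))).
- move=> k u v; rewrite /co (_ : vec _ = vec (val u) + vec (val v)) ?mulmxDl ?mxE //.
  by apply/rowP=> j; rewrite !mxE ffunE.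
- move=> j k; rewrite /co bE -row_mul mxE -val_eqE /=.
  have /matrixP/(_ (val k) (val j)) := DAB.
  rewrite mxE (bigD1 (val j)) //= big1 ?addr0 => [|i ij].
    rewrite !DE eqxx mulr1n => E1; apply: (mulIf (valP j : d`_(val j) != 0)).
    by rewrite E1 [sval j == _]eq_sym; case: eqP => [->|_]; rewrite ?mul1r ?mul0r.
  by rewrite [D i _]DE (negPf ij) mulr0.
move=> u; exists (fun k => co (val k) u); apply: val_inj; apply: vec_inj.
rewrite -[in LHS]fvalK vecM ME !mulmxA -[vec _ *m A *m D *m B]mulmxA.
have vecS (I : finType) (F : I -> {ffun L -> int}) : vec (\sum_i F i) = \sum_i vec (F i).
  by apply/rowP => j; rewrite !mxE sum_ffunE summxE; apply: eq_bigr => i _; rewrite mxE.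
have vecZ x m : vec (x *~ m) = m *: vec x.
  by apply/rowP => j; rewrite !mxE ffun_mulrzE mulrC.
rewrite [X in _ = vec X]raddf_sum vecS.
rewrite [RHS](_ : _ = \sum_(k in [pred k : 'I_n | d`_k != 0])
  co k u *: row k (D *m B)); last first.
  rewrite [RHS]big_sub; apply: eq_bigr => k _.
  by rewrite [X in vec X]raddfMz vecZ bE.
rewrite mulmx_sum_row (bigID (fun k : 'I_n => d`_k != 0)) /= [X in _ + X]big1 ?addr0 //.
move=> k /negPn/eqP dk; rewrite (_ : row k _ = 0) ?scaler0 //.
apply/rowP => j; rewrite !mxE big1 // => i _; rewrite DE dk mul0rn mul0r //.
Qed.

Definition fixed_lattice : glattice gT :=
  GLattice (fixed_actD : forall g, {morph fixed_action^~ g : u v / u + v})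
    fixed_free.

End Idempotent.

Section Retract.
Variables (gT : finGroupType) (L : finType) (to : {action gT &-> L}).

Lemma fixed_invertible (e : {additive {ffun L -> int} -> {ffun L -> int}})
    (eI : forall x, e (e x) = e x)
    (eG : forall x g, e (permZ_act to x g) = permZ_act to (e x) g) :
  invertible_lattice (fixed_lattice eI eG).
Proof.
pose e' : {additive {ffun L -> int} -> {ffun L -> int}} := idfun \- e.
have e'E x : e' x = x - e x by [].
have e'I x : e' (e' x) = e' x by rewrite !e'E raddfB /= eI subrr subr0.
have e'G x g : e' (permZ_act to x g) = permZ_act to (e' x) g.
  rewrite !e'E eG; apply/ffunP => l; by rewrite !ffunE.
exists (permZ to), (fixed_lattice e'I e'G).
exists (\val : {additive fixed_space e -> {ffun L -> int}}).
exists (\val : {additive fixed_space e' -> {ffun L -> int}}).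
split; first exact: permZ_permutation.
split=> // x; exists (fproj eI x, fproj e'I x); split.
  by rewrite /= addrC subrK.
case=> u v /= xE.
have ev : e (val v) = 0.
  apply/eqP; rewrite -oppr_eq0 -[X in _ == X](subrr (val v)) -{2}(fvalK v).
  by rewrite e'E addrAC subrr add0r.
have eu : e x = val u by rewrite xE raddfD /= ev addr0 (fvalK u).
by congr pair; apply: val_inj; rewrite /= eu // xE [_ + val v]addrC addrK.
Qed.

End Retract.

(** In both criteria the exact sequence is M -> Z[I] -> im h, with r splitting
    h modulo M: r (h x) = x + f u.  If h is onto, its image is the permutation
    lattice.  If only h r is equivariant, then h r is an idempotent with the
    image of h as fixed lattice, which is therefore a direct summand. *)
Section Criterion.
Variables (gT : finGroupType) (M : glattice gT) (I L : finType).
Variables (toI : {action gT &-> I}) (toL : {action gT &-> L}).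
Variables (f : {additive M -> permZ toI}) (h : {additive permZ toI -> permZ toL}).
Variable r : {additive permZ toL -> permZ toI}.
Hypotheses (fG : equivariant f) (fI : injective f) (hG : equivariant h).
Hypotheses (hf : forall u, h (f u) = 0) (rh : forall x, exists u, r (h x) = x + f u).

Lemma quasi_permutation_crit : (forall y, h (r y) = y) -> quasi_permutation M.
Proof.
move=> hr; exists (permZ toI), (permZ toL), f, h.
split; [exact: permZ_permutation | exact: permZ_permutation|].
split=> // [x|y]; last by exists (r y).
split=> [hx|[u ->]//]; have [u] := rh x; rewrite hx raddf0 => /esym/eqP.
by rewrite addr_eq0 => /eqP xE; exists (- u); rewrite xE raddfN.
Qed.

Lemma quasi_invertible_crit :
    (forall y g, h (r (lact _ y g)) = h (lact _ (r y) g)) -> quasi_invertible M.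
Proof.
move=> rG; have hrh x : h (r (h x)) = h x.
  by have [u ->] := rh x; rewrite raddfD /= hf addr0.
pose e : {additive {ffun L -> int} -> {ffun L -> int}} := h \o r.
have eI y : e (e y) = e y by rewrite /= hrh.
have eG y g : e (permZ_act toL y g) = permZ_act toL (e y) g.
  by apply: etrans (rG y g) _; apply: etrans (hG _ _) _.
exists (permZ toI), (fixed_lattice eI eG), f, (fproj eI \o h).
split; [exact: permZ_permutation | exact: fixed_invertible|].
split=> // [g x|x|y].
- by apply: val_inj; rewrite /= !hrh; apply: hG.
- split=> [/(congr1 val)/= | [u ->]]; last by apply: val_inj; rewrite /= hf !raddf0.
  rewrite hrh => hx; have [u] := rh x; rewrite hx raddf0 => /esym/eqP.
  by rewrite addr_eq0 => /eqP xE; exists (- u); rewrite xE raddfN.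
by exists (r (val y)); apply: val_inj; rewrite /= hrh; apply: fvalK y.
Qed.

End Criterion.

(** * Multiples of the identity that factor through permutation lattices *)

Section PermFactor.
Variables (gT : finGroupType) (M : glattice gT) (I : finType).
Variables (toI : {action gT &-> I}) (f : {additive M -> permZ toI}).

(** The integer n is in the ideal of those for which n times the identity of
    the cokernel of f factors through some permutation lattice Z[L].  The map
    to Z[L] has the rows A and kills M; the map back has the columns v, lifted
    from the cokernel to Z[I], hence equivariant only modulo M. *)
Definition perm_factor (n : int) : Prop :=
  exists (L : finType) (toL : {action gT &-> L}) (A : L -> I -> int)
         (v : L -> {ffun I -> int}),
  [/\ forall l i g, A (toL l g) (toI i g) = A l i,
      forall u, rowsZ A (f u) = 0,
      forall x, exists u, colsZ v (rowsZ A x) = x *~ n + f u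
    & forall l g, exists u, v (toL l g) = permZ_act toI (v l) g + f u].

Lemma perm_factor_comb m n a b :
  perm_factor m -> perm_factor n -> perm_factor (m * a + n * b).
Proof.
move=> [L [toL [A [v [AG Af rA vG]]]]] [L' [toL' [A' [v' [AG' Af' rA' vG']]]]].
pose B (l : L + L') := match l with inl l => A l | inr l => A' l end.
pose w (l : L + L') := match l with inl l => v l *~ a | inr l => v' l *~ b end.
exists (L + L')%type, (sum_action toL toL'), B, w; split.
- by case=> l i g /=; [apply: AG | apply: AG'].
- move=> u; apply/ffunP => -[l|l]; rewrite !ffunE /B.
    by have /ffunP/(_ l) := Af u; rewrite !ffunE.
  by have /ffunP/(_ l) := Af' u; rewrite !ffunE.
- move=> x; have [u uE] := rA x; have [u' uE'] := rA' x.
  exists (u *~ a + u' *~ b); rewrite raddfD /= !raddfMz /=.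
  rewrite mulrzDr !mulrzA addrACA -!mulrzDl -uE -uE' /colsZ big_sumType /=.
  rewrite !mulrz_suml; congr (_ + _); apply: eq_bigr => l _.
    by rewrite !ffunE mulrzAC.
  by rewrite !ffunE mulrzAC.
have actZ x n' g : permZ_act toI (x *~ n') g = permZ_act toI x g *~ n'.
  by apply/ffunP => i; rewrite ffunE !ffun_mulrzE ffunE.
case=> l g /=.
  by have [u ->] := vG l g; exists (u *~ a); rewrite mulrzDl actZ raddfMz.
by have [u ->] := vG' l g; exists (u *~ b); rewrite mulrzDl actZ raddfMz.
Qed.

Lemma perm_factor1_quasi_invertible :
  equivariant f -> injective f -> perm_factor 1 -> quasi_invertible M.
Proof.
move=> fG fI [L [toL [A [v [AG Af rA vG]]]]].
apply: (@quasi_invertible_crit _ _ _ _ toI toL f (rowsZ A) (colsZ v)) => //.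
- exact: rowsZ_equivariant.
apply: (@colsZ_equivariant_mod _ _ _ toI toL v (rowsZ A)) => l g.
by have [u ->] := vG l g; rewrite raddfD /= Af addr0.
Qed.

End PermFactor.

(** * The factorization attached to the points of X *)

Section JSignFactors.
Variables (K : finGroupType) (X : finType) (to : {action K &-> X}).
Local Notation jd := (@jdiff _ _ to).
Local Notation swapP := (swap_action to).

Lemma swap_actionE ij g : swapP ij g =
  if g \in leftfactor K then (to ij.1 g.1, to ij.2 g.1)
  else (to ij.2 g.1, to ij.1 g.1).
Proof. by rewrite /= /twist_act; case: ifP. Qed.

Definition rowsum (i : X) : {ffun X * X -> int} := [ffun ab => (ab.1 == i)%:R].
Definition colsum (i : X) : {ffun X * X -> int} := [ffun ab => (ab.2 == i)%:R].

Lemma rowsum_colsum i : rowsum i = colsum i + jd (mkJ to (dirac i)).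
Proof.
by apply/ffunP => -[a b]; rewrite !ffunE jdiff_mk !ffunE /= addrC subrK.
Qed.

(** For a point o the functionals x_io + x_oi and x_jk - x_jo - x_ok vanish on
    all differences a i - a j.  Paired with the row sums and with the pairs
    (j, k), they give x back modulo J, compatibly with the stabilizer of o;
    the disjoint union over o restores equivariance under the whole group. *)
Definition star_row (l : X * X + X * (X * X)) (ab : X * X) : int :=
  match l with
  | inl (o, i) => (ab == (i, o))%:R + (ab == (o, i))%:R
  | inr (o, jk) => (ab == jk)%:R - (ab == (jk.1, o))%:R - (ab == (o, jk.2))%:R
  end.

Definition star_col (l : X * X + X * (X * X)) : {ffun X * X -> int} :=
  match l with
  | inl (o, i) => rowsum i
  | inr (o, jk) => dirac jk
  end.

(** For each o the composition is x plus the difference function of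
    i |-> x_oi. *)
Lemma perm_factor_card : perm_factor (toI := swapP) jd #|X|%:Z.
Proof.
exists (X * X + X * (X * X))%type.
exists (sum_action (prod_action (inflate to) (inflate to))
         (prod_action (inflate to) swapP)).
exists star_row, star_col.
have rowE x l : rowsZ star_row x l = match l with
  | inl (o, i) => x (i, o) + x (o, i)
  | inr (o, jk) => x jk - x (jk.1, o) - x (o, jk.2) end.
  rewrite ffunE; case: l => [[o i]|[o jk]] /=.
    by under eq_bigr do rewrite mulrDl; rewrite big_split /= !sum_indicator.
  under eq_bigr do rewrite !mulrBl.
  by rewrite !sumrB !sum_indicator.
split.
- have toI := act_inj to.
  case=> [[o i]|[o [j k]]] [a b] g; rewrite /star_row /= /inflate_act ?swap_actionE /=;
    rewrite /twist_act /=; case: ifP => _; rewrite /= !xpair_eqE !(inj_eq (toI _)) //.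
  - by rewrite addrC; congr (_%:R + _%:R); rewrite andbC.
  rewrite addrAC; congr (_%:R - _%:R - _%:R); by rewrite andbC.
- move=> u; have [a ->] := mkJ_surj u; apply/ffunP => l; rewrite rowE !ffunE.
  by case: l => [[o i]|[o [j k]]]; rewrite !jdiff_mk /=; ring.
- move=> x.
  pose s o : {ffun X -> int} := [ffun i => x (o, i)].
  exists (mkJ to (\sum_o s o)); apply/ffunP => -[a b].
  rewrite sum_ffunE ffunE ffun_mulrzE jdiff_mk /= !sum_ffunE.
  have sumE (F : X * X + X * (X * X) -> int) :
      \sum_l F l = \sum_o (\sum_i F (inl (o, i)) + \sum_jk F (inr (o, jk))).
    by rewrite big_sumType /= big_split /= !pair_bigA; congr (_ + _);
      apply: eq_bigr => -[].
  have -> : x (a, b) * #|X|%:Z = \sum_(o : X) x (a, b).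
    by rewrite sumr_const -mulr_natr natz.
  rewrite sumE -sumrB -big_split /=; apply: eq_bigr => o _.
  have rowE' l : (star_col l *~ rowsZ star_row x l) (a, b) =
      star_col l (a, b) * match l with
  | inl (o, i) => x (i, o) + x (o, i)
  | inr (o, jk) => x jk - x (jk.1, o) - x (o, jk.2) end.
    by rewrite ffun_mulrzE rowE.
  under eq_bigr do rewrite rowE' /= ffunE /= eq_sym.
  under [X in _ + X]eq_bigr do rewrite rowE' /= ffunE eq_sym !mulrBr.
  rewrite !sumrB sum_indicator !ffunE.
  rewrite sum_indicator (bigD1 (a, b)) //= eqxx mul1r big1 => [|i /negPf ->]; last by rewrite mul0r.
  rewrite (bigD1 (a, b)) //= eqxx mul1r big1 => [|i /negPf ->]; last by rewrite mul0r.
  by ring.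
case=> [[o i]|[o jk]] g /=.
  have [g1|g1] := boolP (g \in leftfactor K).
    exists 0; rewrite raddf0 addr0; apply/ffunP => -[a b].
    rewrite !ffunE /= /twist_act groupV g1 /= /inflate_act.
    by rewrite (canF_eq (actKV to _)).
  exists (mkJ to (dirac (to i g.1))); rewrite rowsum_colsum; congr (_ + _).
  apply/ffunP => -[a b].
  rewrite !ffunE /= /twist_act groupV (negPf g1) /= /inflate_act.
  by rewrite (canF_eq (actKV to _)).
by exists 0; rewrite raddf0 addr0 -(dirac_act swapP).
Qed.

End JSignFactors.

(** * Cyclic orders and their arcs *)

Section CyclicOrder.
Variable X : finType.

Definition cyclic_order (s : X -> X) : Prop :=
  injective s /\ forall x y, fconnect s x y.

(** The edge from m to s m lies on the arc that follows s from i to j. *)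
Definition on_arc (s : X -> X) (i m j : X) : bool := (findex s i m < findex s i j)%N.

Section Theory.
Variables (s : X -> X) (sC : cyclic_order s).

Let sI : injective s. Proof. by case: sC. Qed.
Let sT x y : fconnect s x y. Proof. by case: sC. Qed.

Lemma cyclic_order_size x : fingraph.order s x = #|X|.
Proof. by apply: eq_card => y; rewrite !inE; apply: sT. Qed.

Lemma findex_lt x y : (findex s x y < #|X|)%N.
Proof. by rewrite -(cyclic_order_size x) findex_max. Qed.

Lemma findex_uniq k x y : (k < #|X|)%N -> iter k s x = y -> findex s x y = k.
Proof. by move=> kX <-; rewrite findex_iter // cyclic_order_size. Qed.

Lemma findex_add x y z : findex s x z =
  if (findex s x y + findex s y z < #|X|)%N then (findex s x y + findex s y z)%N
  else (findex s x y + findex s y z - #|X|)%N.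
Proof.
have xz : iter (findex s x y + findex s y z) s x = z.
  by rewrite addnC iterD !iter_findex.
case: ltnP => xyz; apply: findex_uniq => //.
  by have := findex_lt x y; have := findex_lt y z; lia.
rewrite -[RHS]xz -[in RHS](subnK xyz) iterD; congr iter.
by rewrite -[#|X|](cyclic_order_size x) iter_order.
Qed.

Lemma findex_next x : findex s x (s x) = (1 %% #|X|)%N.
Proof.
have X0 : (0 < #|X|)%N by apply/card_gt0P; exists x.
apply: findex_uniq; first by rewrite ltn_mod.
have [X1|X1] := ltnP 1 #|X|; first by rewrite modn_small.
have {X0}X1 : #|X| = 1%N by apply/eqP; rewrite eqn_leq X1.
by rewrite X1 modn1; apply: (fintype_le1P _ _) => //; rewrite X1.
Qed.

Lemma findex_eq x y z : (findex s x y == findex s x z) = (y == z).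
Proof.
apply/eqP/eqP => [yz|-> //].
by rewrite -(iter_findex (sT x y)) yz iter_findex.
Qed.

(** Moving the edge by one step along s only affects the arcs that start or
    end at the point in between.  Summed up, this is why the cut of a cyclic
    order matters only up to J. *)
Lemma on_arc_next i m j :
  (on_arc s i m j)%:R - (on_arc s i (s m) j)%:R = (s m == j)%:R - (s m == i)%:R :> int.
Proof.
have im := findex_add i m (s m); have ii := findex0 s i.
have im_lt := findex_lt i m; have ij_lt := findex_lt i j.
rewrite findex_next in im.
have E : (on_arc s i m j + (s m == i) = on_arc s i (s m) j + (s m == j))%N.
  rewrite /on_arc -[s m == j](findex_eq i) -[s m == i](findex_eq i) ii.
  have [X1|X1] := leqP #|X| 1; first by have := findex_lt i (s m); lia.
  rewrite modn_small // in im.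
  by move: im; case: ltnP; lia.
have {}E := congr1 (fun k => k%:R : int) E; rewrite !natrD in E.
by apply/eqP; rewrite subr_eq addrAC [X in X - _]addrC -E addrK.
Qed.

End Theory.

Section Transport.
Variables (s t : X -> X) (sC : cyclic_order s) (tC : cyclic_order t).
Variable phi : X -> X.
Let sT x y : fconnect s x y. Proof. by case: sC. Qed.

Lemma on_arc_morph : (forall x, t (phi x) = phi (s x)) ->
  forall i m j, on_arc t (phi i) (phi m) (phi j) = on_arc s i m j.
Proof.
move=> tphi; suff E x y : findex t (phi x) (phi y) = findex s x y.
  by move=> i m j; rewrite /on_arc !E.
apply: (findex_uniq tC); first exact: findex_lt.
have {2}<- := iter_findex (sT x y).
by elim: (findex s x y) => //= k ->.
Qed.

(** A map that reverses the orientation turns the edge m -> s m of the arc from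
    i to j into the edge phi (s m) -> phi m of the arc from phi j to phi i. *)
Lemma on_arc_anti : (forall x, t (phi (s x)) = phi x) ->
  forall i m j, on_arc t (phi j) (phi (s m)) (phi i) = on_arc s i m j.
Proof.
move=> tphi; have E x y : findex t (phi y) (phi x) = findex s x y.
  apply: (findex_uniq tC); first exact: findex_lt.
  have {2}<- := iter_findex (sT x y).
  by elim: (findex s x y) => //= k IH; rewrite -iterS iterSr tphi.
move=> i m j; rewrite /on_arc !E.
have im := findex_add sC i m j; have mj := findex_add sC m (s m) j.
have := findex_lt sC i m; have := findex_lt sC i j; have := findex_lt sC (s m) j.
rewrite (findex_next sC) in mj; have [X1|X1] := leqP #|X| 1.
  by clear im mj; lia.
rewrite modn_small // in mj.
by move: im mj; do 2![case: ltnP => ?] => ? ? ? ? ?; apply/idP/idP; lia.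
Qed.

End Transport.
End CyclicOrder.

(** * The factorization attached to a family of cyclic orders *)

Section CycleFactor.
Variables (K : finGroupType) (X W : finType) (to : {action K &-> X}).
Variables (toW : {action timesC2 K &-> W}) (nx : W -> X -> X) (x0 : X).
Local Notation jd := (@jdiff _ _ to).
Local Notation swapP := (swap_action to).
(* The left factor transports the successor maps nx w; elements outside it
   also reverse them. *)
Hypothesis nxC : forall w, cyclic_order (nx w).
Hypothesis nx_left : forall w g x, g \in leftfactor K ->
  nx (toW w g) (to x g.1) = to (nx w x) g.1.
Hypothesis nx_right : forall w g x, g \notin leftfactor K ->
  nx (toW w g) (to (nx w x) g.1) = to x g.1.

(** The functionals are circulations: the sum over the cycle w, and the edge
    (i, j) minus the path from i to j along w.  Circulations are the
    functionals that vanish on J. *)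
Definition cycle_row (l : W + W * (X * X)) (ab : X * X) : int :=
  match l with
  | inl w => (nx w ab.1 == ab.2)%:R
  | inr (w, ij) => (ab == ij)%:R
      - ((nx w ab.1 == ab.2) && on_arc (nx w) ij.1 ab.1 ij.2)%:R
  end.

(** The set of the pairs (i, j) whose arc passes through the edge m -> nx w m.
    If w is cut open at this edge, these are the pairs with i after j. *)
Definition cut (w : W) (m : X) : {ffun X * X -> int} :=
  [ffun ij => (on_arc (nx w) ij.1 m ij.2)%:R].

Definition cycle_col (l : W + W * (X * X)) : {ffun X * X -> int} :=
  match l with inl w => cut w x0 | inr (w, ij) => dirac ij end.

Lemma cut_next w m : cut w m = cut w (nx w m) + jd (mkJ to (- dirac (nx w m))).
Proof.
apply/ffunP => -[i j]; rewrite !ffunE jdiff_mk !ffunE /=.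
apply/eqP; rewrite addrC -subr_eq on_arc_next // opprK addrC.
by rewrite [i == _]eq_sym [j == _]eq_sym.
Qed.

Lemma cut_indep w m m' : exists u, cut w m = cut w m' + jd u.
Proof.
have [_ nxT] := nxC w; rewrite -(iter_findex (nxT m m')).
elim: (findex _ _ _) => [|k [u ->]] /=; first by exists 0; rewrite raddf0 addr0.
by rewrite (cut_next w (iter k _ m)) -addrA -raddfD; eexists.
Qed.

Lemma cut_act w m g :
  exists m', permZ_act swapP (cut w m) g = cut (toW w g) m'.
Proof.
have [g1|g1] := boolP (g \in leftfactor K);
  [exists (to m g.1) | exists (to (nx w m) g.1)];
  apply/ffunP => -[i j]; rewrite !ffunE swap_actionE groupV ?g1 ?(negPf g1) /=.
  rewrite -{2}(actKV to g.1 i) -{2}(actKV to g.1 j).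
  by rewrite (on_arc_morph (phi := to^~ g.1) (nxC w) (nxC (toW w g))) // => x; rewrite nx_left.
rewrite -{2}(actKV to g.1 i) -{2}(actKV to g.1 j).
by rewrite (on_arc_anti (phi := to^~ g.1) (nxC w) (nxC (toW w g))) // => x; rewrite nx_right.
Qed.

Lemma next_sum w (x : {ffun X * X -> int}) (F : X -> int) :
  \sum_ab (nx w ab.1 == ab.2)%:R * F ab.1 * x ab = \sum_m F m * x (m, nx w m).
Proof.
transitivity (\sum_a \sum_b (nx w a == b)%:R * F a * x (a, b)).
  by rewrite pair_bigA; apply: eq_bigr => -[].
apply: eq_bigr => m _; rewrite (bigD1 (nx w m)) //= eqxx mul1r big1 ?addr0 //.
by move=> b; rewrite eq_sym => /negPf ->; rewrite !mul0r.
Qed.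

Lemma cycle_rowE x l : rowsZ cycle_row x l =
  match l with
  | inl w => \sum_m x (m, nx w m)
  | inr (w, ij) => x ij - \sum_m (on_arc (nx w) ij.1 m ij.2)%:R * x (m, nx w m)
  end.
Proof.
rewrite ffunE; case: l => [w|[w ij]] /=.
  transitivity (\sum_ab (nx w ab.1 == ab.2)%:R * 1 * x ab).
    by apply: eq_bigr => ab _; rewrite mulr1.
  by rewrite (next_sum w x (fun=> 1)); apply: eq_bigr => m _; rewrite mul1r.
under eq_bigr do rewrite mulrBl -mulnb natrM.
by rewrite sumrB sum_indicator (next_sum w x (fun m => (on_arc (nx w) ij.1 m ij.2)%:R)).
Qed.

(** For each w the arcs from i to j contribute the sum over m of
    x_(m, nx w m) * cut w m, with a minus sign.  All these cuts have the class
    of cut w x0, so the single term of the cycle w compensates for them. *)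
Lemma perm_factor_cycles : perm_factor (toI := swapP) jd #|W|%:Z.
Proof.
exists (W + W * (X * X))%type, (sum_action toW (prod_action toW swapP)).
exists cycle_row, cycle_col; split.
- move=> l [a b] g; have toI := act_inj to.
  have edge w : (nx (toW w g) (swapP (a, b) g).1 == (swapP (a, b) g).2) = (nx w a == b).
    rewrite swap_actionE; case: ifPn => gN /=.
      by rewrite nx_left // (inj_eq (toI _)).
    have [nxI _] := nxC (toW w g).
    by rewrite -(nx_right w a gN) (inj_eq nxI) (inj_eq (toI _)) eq_sym.
  pose p := swapP (a, b) g; case: l => [w|[w [i j]]].
    by change ((nx (toW w g) p.1 == p.2)%:R = (nx w a == b)%:R :> int); rewrite edge.
  pose q := swapP (i, j) g.
  change ((p == q)%:R - ((nx (toW w g) p.1 == p.2)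
      && on_arc (nx (toW w g)) q.1 p.1 q.2)%:R = ((a, b) == (i, j))%:R
      - ((nx w a == b) && on_arc (nx w) i a j)%:R :> int).
  rewrite edge (inj_eq (act_inj swapP g)); congr (_ - _%:R); congr nat_of_bool; case: eqP => //= ab.
  rewrite /p /q !swap_actionE; case: ifPn => gN /=.
    by rewrite (on_arc_morph (phi := to^~ g.1) (nxC w) (nxC (toW w g))) // => x; rewrite nx_left.
  by rewrite -ab (on_arc_anti (phi := to^~ g.1) (nxC w) (nxC (toW w g))) // => x; rewrite nx_right.
- move=> u; have [a ->] := mkJ_surj u; apply/ffunP => l; rewrite cycle_rowE ffunE.
  case: l => [w|[w [i j]]]; have [nxI _] := nxC w.
    under eq_bigr do rewrite jdiff_mk /=.
    by rewrite sumrB [X in X - _](reindex_inj nxI) subrr.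
  under eq_bigr do rewrite jdiff_mk /= mulrBr.
  rewrite jdiff_mk sumrB [X in _ - (X - _)](reindex_inj nxI) -sumrB /=.
  under eq_bigr do rewrite -mulrBl -[_ - _]opprB on_arc_next // opprB mulrBl.
  rewrite sumrB -!(reindex_inj nxI (P := xpredT) (F := fun m => (m == _)%:R * a m)).
  by rewrite !sum_indicator subrr.
- move=> x; move: (cycle_rowE x); move: (rowsZ cycle_row x) => h hE.
  have per w : exists u, cycle_col (inl w) *~ h (inl w)
      + \sum_ij cycle_col (inr (w, ij)) *~ h (inr (w, ij)) = x + jd u.
    have [u uE] := fin_all_exists (cut_indep w x0).
    exists (\sum_m u m *~ x (m, nx w m)); apply/ffunP => ab.
    rewrite [in LHS]ffunE [in RHS]ffunE raddf_sum !sum_ffunE ffun_mulrzE hE.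
    rewrite [X in _ + X = _](bigD1 ab) //= [X in _ + (_ + X)]big1 => [|ij ne]; last first.
      by rewrite ffun_mulrzE ffunE eq_sym (negPf ne) mul0r.
    rewrite ffun_mulrzE hE [dirac ab ab]ffunE eqxx mul1r addr0 mulr_sumr.
    have cE m : cut w x0 ab * x (m, nx w m) =
        (on_arc (nx w) ab.1 m ab.2)%:R * x (m, nx w m) + jd (u m *~ x (m, nx w m)) ab.
      by rewrite (uE m) ffunE mulrDl raddfMz ffun_mulrzE ffunE.
    rewrite (eq_bigr _ (fun m _ => cE m)) big_split /= [LHS]addrC [LHS]addrA.
    by congr (_ + _); rewrite subrK.
  have [u uE] := fin_all_exists per; exists (\sum_w u w).
  transitivity (\sum_w (cycle_col (inl w) *~ h (inl w)
      + \sum_ij cycle_col (inr (w, ij)) *~ h (inr (w, ij)))).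
    rewrite big_split /= pair_bigA /colsZ big_sumType /=; congr (_ + _).
    by apply: eq_bigr => -[].
  rewrite (eq_bigr _ (fun w _ => uE w)) big_split /= sumr_const raddf_sum.
  by rewrite pmulrn.
case=> [w|[w ij]] g /=.
  have [m' ->] := cut_act w x0 g.
  by have [u ->] := cut_indep (toW w g) x0 m'; exists u.
by exists 0; rewrite raddf0 addr0 -(dirac_act swapP).
Qed.

End CycleFactor.

(** * Quasi-invertibility for the symmetric group of prime degree *)

Definition rotation n : 'S_n := perm (@ordS_inj n).

Lemma rotation_iter n k (x : 'I_n) : (rotation n ^+ k)%g x = ((x + k) %% n)%N :> nat.
Proof.
elim: k => [|k IH]; first by rewrite perm1 addn0 modn_small.
by rewrite expgSr permM permE /= IH addnS -addn1 modnDml addn1.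
Qed.

Lemma rotation_cyclic n : cyclic_order (rotation n).
Proof.
split=> [|x y]; first exact: perm_inj.
have -> : y = iter (y + (n - x)) (rotation n) x.
  apply: val_inj; rewrite -permX /= rotation_iter addnCA subnKC 1?ltnW //.
  by rewrite modnDr modn_small.
exact: fconnect_iter.
Qed.

Lemma rotation_exp n : (rotation n ^+ n = 1)%g.
Proof.
apply/permP => x; apply: val_inj.
by rewrite /= rotation_iter modnDr modn_small // perm1.
Qed.

Lemma order_rotation n : prime n -> #[rotation n]%g = n.
Proof.
move=> n_pr; apply: nt_prime_order (rotation_exp n) _ => //.
apply/eqP => /permP/(_ (Ordinal (prime_gt0 n_pr)))/(congr1 val).
by rewrite perm1 permE /= modn_small ?prime_gt1.
Qed.

Section CycleClass.
Variables (n : nat).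
Implicit Types s : 'S_n.
Local Notation c := (rotation n).
Local Notation cycles := (c ^: [set: 'S_n])%g.

Lemma cycles_conj (w : 'S_n) s : w \in cycles -> (w ^ s)%g \in cycles.
Proof. by case/imsetP => t _ ->; rewrite -conjgM memJ_class ?inE. Qed.

(** The reflection i |-> n - 1 - i conjugates the rotation to its inverse. *)
Lemma cycles_inv (w : 'S_n) : w \in cycles -> (w^-1)%g \in cycles.
Proof.
case/imsetP => t _ ->; rewrite -conjVg; apply: cycles_conj.
apply/imsetP; exists (perm (@rev_ord_inj n)); rewrite ?inE //.
apply/permP => x; apply: (@perm_inj _ c); rewrite permKV.
rewrite -{2}[x](rev_ordK x) -[rev_ord (rev_ord x)](permE (@rev_ord_inj n)).
rewrite permJ !permE; apply: val_inj => /=; have := ltn_ord x; set y := (n - x.+1)%N.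
move=> xn; have -> : x = (n - y.+1)%N :> nat by rewrite /y; lia.
have yn : (y < n)%N by rewrite /y; lia.
have [y1|y1] := ltnP y.+1 n; first by rewrite !modn_small //; lia.
have -> : y.+1 = n by lia.
by rewrite modnn subnn subn1 prednK ?modnn //; lia.
Qed.

Definition cycle_type := {w : 'S_n | w \in cycles}.

Definition cycle_conj (w : cycle_type) s : cycle_type :=
  exist _ (val w ^ s)%g (cycles_conj s (valP w)).
Definition cycle_inv (w : cycle_type) : cycle_type :=
  exist _ (val w)^-1%g (cycles_inv (valP w)).

Lemma cycle_conj1 w : cycle_conj w 1%g = w.
Proof. by apply: val_inj; apply: conjg1. Qed.
Lemma cycle_conjM w s t : cycle_conj w (s * t)%g = cycle_conj (cycle_conj w s) t.
Proof. by apply: val_inj; apply: conjgM. Qed.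
Lemma cycle_invK : involutive cycle_inv.
Proof. by move=> w; apply: val_inj; apply: invgK. Qed.
Lemma cycle_invC w s :
  cycle_inv (TotalAction cycle_conj1 cycle_conjM w s) =
  TotalAction cycle_conj1 cycle_conjM (cycle_inv w) s.
Proof. by apply: val_inj; rewrite /= conjVg. Qed.

Definition cycle_action : {action timesC2 'S_n &-> cycle_type} :=
  twist cycle_invK cycle_invC.

Lemma cycles_cyclic (w : cycle_type) : cyclic_order (val w).
Proof.
split; first exact: perm_inj.
case: w => _ /= /imsetP[s _ ->] x y; rewrite -(permKV s x) -(permKV s y).
have [_ /(_ (s^-1%g x) (s^-1%g y)) /iter_findex <-] := rotation_cyclic n.
set k := findex _ _ _; have -> : s (iter k c (s^-1%g x)) = iter k (c ^ s)%g (s (s^-1%g x)).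
  by elim: k => //= k <-; rewrite permJ.
exact: fconnect_iter.
Qed.

Lemma perm_factor_cycle_type (x0 : 'I_n) :
  perm_factor (toI := swap_action ('P : {action 'S_n &-> 'I_n}))
    (jdiff (to := ('P : {action 'S_n &-> 'I_n}))) #|{: cycle_type}|%:Z.
Proof.
apply: (@perm_factor_cycles _ _ _ 'P cycle_action
  (fun w : cycle_type => val w : 'I_n -> 'I_n) x0).
- exact: cycles_cyclic.
- by move=> w g x gN; rewrite /= /twist_act gN /= /aperm permJ.
by move=> w g x gN; rewrite /= /twist_act (negPf gN) /= /aperm -(permJ (val w) g.1 x) permK.
Qed.

(** The centralizer of the rotation contains the n powers of the rotation, so
    the size of the class divides (n - 1)!. *)
Lemma coprime_card_cycles : prime n -> coprime n #|{: cycle_type}|.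
Proof.
move=> n_pr; rewrite card_sig prime_coprime //.
have /dvdnP[m Cm] : (n %| #|'C_[set: 'S_n][c]%g|)%N.
  by rewrite -{1}(order_rotation n_pr) order_dvdG // inE cent1id inE.
have E := Lagrange (subsetIl [set: 'S_n] 'C[c]%g).
rewrite Cm index_cent1 cardsT card_Sn in E.
have factE k : (0 < k)%N -> (k`! = k * (k.-1)`!)%N by case: k.
have {E}mE : (m * #|cycles| = (n.-1)`!)%N.
  apply/eqP; rewrite -(eqn_pmul2l (prime_gt0 n_pr)) mulnA [(n * m)%N]mulnC.
  by apply/eqP; apply: etrans E _; apply: factE; apply: prime_gt0.
apply/negP => n_dvd.
have : (n %| (n.-1)`!)%N by rewrite -mE dvdn_mull.
have : (n.-1 < n)%N by rewrite prednK ?prime_gt0.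
elim: n.-1 => [|k IH] kn; first by rewrite dvdn1; case: eqP kn n_pr => // ->.
rewrite factS Euclid_dvdM // => /orP[/dvdn_leq|]; first by move/(_ isT); lia.
by apply: IH; lia.
Qed.

Lemma J_sign_quasi_invertible : prime n ->
  quasi_invertible (J_sign ('P : {action 'S_n &-> 'I_n})).
Proof.
move=> n_pr; have := coprime_card_cycles n_pr.
set m := #|_| => nm.
have [u [v uv]] : exists u v : int, n%:Z * u + m%:Z * v = 1.
  have [u [v E]] := Bezoutz n m; exists u, v.
  by rewrite [LHS]addrC [n%:Z * u]mulrC [m%:Z * v]mulrC addrC E /gcdz /= (eqP nm).
apply: (perm_factor1_quasi_invertible
  (f := jdiff (to := ('P : {action 'S_n &-> 'I_n})))
  (toI := swap_action ('P : {action 'S_n &-> 'I_n}))).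
- exact: jdiff_equivariant.
- exact: jdiff_inj.
rewrite -uv; apply: perm_factor_comb; last exact/perm_factor_cycle_type/Ordinal/prime_gt0.
have := perm_factor_card ('P : {action 'S_n &-> 'I_n}); by rewrite card_ord.
Qed.

End CycleClass.

(** * Resolutions in terms of permuted bases *)

Section LactAdditive.
Variables (gT : finGroupType) (M : glattice gT) (g : gT).

Definition lact_at (u : M) : M := lact M u g.

Lemma lact_atB : {morph lact_at : u v / u - v}.
Proof.
by move=> u v; apply/eqP; rewrite eq_sym subr_eq /lact_at -lactD subrK.
Qed.
HB.instance Definition _ := GRing.isZmodMorphism.Build M M lact_at lact_atB.

End LactAdditive.

Section PermutationForm.
Variable gT : finGroupType.

Lemma permutation_lattice_form (P : glattice gT) : permutation_lattice P ->
  exists (I : finType) (to : {action gT &-> I})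
         (phi : {additive P -> permZ to}) (psi : {additive permZ to -> P}),
    [/\ equivariant phi, equivariant psi, cancel phi psi & cancel psi phi].
Proof.
case=> I [b [bZ bP]]; have [co [coD cob uE]] := Zbasis_coord bZ.
have b_inj : injective b.
  move=> i j /(congr1 (co i)); rewrite !cob eqxx.
  by case: eqP.
have [a aP] : exists a : I -> gT -> I, forall i g, lact P (b i) g = b (a i g).
  apply: (@fin_all_exists I (fun=> gT -> I)
    (fun i ai => forall g, lact P (b i) g = b (ai g))) => i.
  exact: (@fin_all_exists gT (fun=> I) (fun g j => lact P (b i) g = b j)).
have a1 i : a i 1%g = i by apply: b_inj; rewrite -aP tact1.
have aM i g h : a i (g * h)%g = a (a i g) h.
  by apply: b_inj; rewrite -!aP tactM.
pose to : {action gT &-> I} := TotalAction a1 aM.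
pose phi0 (u : P) : {ffun I -> int} := [ffun i => co i u].
have phiB : {morph phi0 : u v / u - v}.
  move=> u v; apply/ffunP => i; rewrite !ffunE; apply/eqP.
  by rewrite eq_sym subr_eq -coD subrK.
pose psi0 (x : {ffun I -> int}) : P := \sum_i b i *~ x i.
have psiB : {morph psi0 : x y / x - y}.
  move=> x y; rewrite /psi0 -sumrB; apply: eq_bigr => i _.
  by rewrite !ffunE mulrzBr.
pose phi : {additive P -> permZ to} :=
  HB.pack phi0 (GRing.isZmodMorphism.Build P (permZ to) phi0 phiB).
pose psi : {additive permZ to -> P} :=
  HB.pack psi0 (GRing.isZmodMorphism.Build (permZ to) P psi0 psiB).
have phiK : cancel phi psi.
  by move=> u; rewrite [RHS]uE; apply: eq_bigr => i _; rewrite ffunE.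
have psi_inj : injective psi.
  move=> x y xy; have [c [_ cU]] := bZ (psi x).
  by rewrite -(cU x) ?(cU y).
have psiK : cancel psi phi by move=> x; apply: psi_inj; rewrite phiK.
have psiG : equivariant psi.
  move=> g x; rewrite -[RHS]/(lact_at g (psi x)) [RHS]raddf_sum /= /psi0.
  rewrite (reindex_inj (act_inj to g)); apply: eq_bigr => i _.
  rewrite [RHS]raddfMz /= /lact_at aP ffunE; congr (_ *~ _).
  by congr (x _); apply: (actK to).
exists I, to, phi, psi; split=> // g u.
by apply: psi_inj; rewrite psiG !phiK.
Qed.

Lemma quasi_permutation_form (M : glattice gT) : quasi_permutation M ->
  exists (I L : finType) (toI : {action gT &-> I}) (toL : {action gT &-> L})
    (f : {additive M -> permZ toI}) (h : {additive permZ toI -> permZ toL}),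
    short_exact f h.
Proof.
case=> P [Q [f [h [/permutation_lattice_form[I [toI [p [p' [pG p'G pK p'K]]]]]
  /permutation_lattice_form[L [toL [q [q' [qG q'G qK q'K]]]]]
  [fG hG fI ex hS]]]]].
exists I, L, toI, toL, (p \o f), (q \o (h \o p')); split.
- by move=> g u /=; rewrite fG pG.
- by move=> g u /=; rewrite p'G hG qG.
- by move=> u v /(can_inj pK)/fI.
- move=> x /=; split=> [hx|[u ->]].
    have /ex[u uE] : h (p' x) = 0 by apply: (can_inj qK); rewrite hx raddf0.
    by exists u; rewrite -uE p'K.
  by rewrite pK (_ : h (f u) = 0) ?raddf0 //; apply/ex; exists u.
by move=> y; have [x xE] := hS (q' y); exists (p x); rewrite /= pK xE q'K.
Qed.

End PermutationForm.

(** * Cohomology of a cyclic group of prime order on a permutation lattice *)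

Section CyclicNorm.
Variables (I : finType) (s : I -> I) (p : nat).
Hypotheses (p_pr : prime p) (s_inj : injective s) (sp : forall i, iter p s i = i).
Implicit Types x y : {ffun I -> int}.

Definition shift x : {ffun I -> int} := [ffun i => x (s i)].
Definition cyclic_norm x : {ffun I -> int} := [ffun i => \sum_(k < p) x (iter k s i)].

(** An invariant function is a norm as soon as p divides its values at the
    fixed points: on a free orbit it is the norm of its restriction to one
    point.  Hence the residues mod p at the fixed points are coordinates on
    the Tate group H^0. *)
Lemma norm_surj x : shift x = x -> (forall i, s i = i -> (p %| x i)%Z) ->
  exists y, x = cyclic_norm y.
Proof.
move=> /ffunP sx px.
(* This witness is supported on the representatives of the orbits. *)
exists [ffun i => if froot s i == i then if s i == i then (x i %/ p)%Z else x i else 0].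
have fs := fconnect_sym s_inj.
apply/ffunP => i; rewrite ffunE.
have [si|si] := eqVneq (s i) i.
  rewrite (eq_bigr (fun=> (x i %/ p)%Z)) => [|k _].
    by rewrite sumr_const card_ord -mulr_natr natz divzK ?px.
  have -> : iter k s i = i by elim: (k : nat) => //= m ->.
  have /eqP ri : froot s i == i.
    have := connect_root (frel s) i => /iter_findex; set m := findex _ _ _ => <-.
    by apply/eqP; elim: m => //= m ->.
  by rewrite ffunE ri si !eqxx.
have o_dvd : (fingraph.order s i %| p)%N.
  have o0 : (0 < fingraph.order s i)%N by exact: fingraph.order_gt0.
  have io m : iter (m * fingraph.order s i) s i = i.
    by elim: m => // m IH; rewrite mulSn iterD IH iter_order.
  have := sp i; rewrite {1}(divn_eq p (fingraph.order s i)) addnC iterD io => pi.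
  have := findex_iter (ltn_pmod p o0); rewrite pi findex0 => pm.
  by rewrite /dvdn -pm.
have oE : fingraph.order s i = p.
  move/primeP: p_pr => [_ /(_ _ o_dvd)/orP[/eqP o1|/eqP//]].
  by case/eqP: si; have := iter_order s_inj i; rewrite o1.
have ir := connect_root (frel s) i.
have k0P : (findex s i (froot s i) < p)%N by rewrite -oE findex_max.
have xk k : x (iter k s i) = x i.
  by elim: k => //= k <-; have := sx (iter k s i); rewrite ffunE.
rewrite (bigD1 (Ordinal k0P)) //= big1 => [|k].
  rewrite iter_findex // ffunE root_root // eqxx.
  have sr : s (froot s i) != froot s i.
    apply: contra si => /eqP sr.
    have : fconnect s (froot s i) i by rewrite fs.
    move/iter_findex; set m := findex _ _ _; have -> : iter m s (froot s i) = froot s i.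
      by elim: m => //= m ->.
    by move=> <-; rewrite sr.
  by rewrite (negPf sr) addr0 -(iter_findex ir) xk.
rewrite -val_eqE /= => kk; rewrite ffunE ifN //.
apply: contra kk => /eqP E.
by rewrite (fingraph.rootP fs (fconnect_iter s k i)) E findex_iter // oE.
Qed.

(** This is H^1 = 0.  Modulo the differences shift y - y all points of an
    orbit are equivalent, so x can be moved to the representatives of the
    orbits, where its coefficients are the sums of x over the orbits.  These
    vanish, since p times such a sum is a sum of values of the norm. *)
Lemma norm_ker x : cyclic_norm x = 0 -> exists y, x = shift y - y.
Proof.
move=> /ffunP Nx; have fs := fconnect_sym s_inj.
pose S x := exists y, x = shift y - y.
have S0 : S 0 by exists 0; apply/ffunP => i; rewrite !ffunE.
have SD u v : S u -> S v -> S (u + v).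
  by move=> [y ->] [z ->]; exists (y + z); apply/ffunP => i; rewrite !ffunE; ring.
have SZ u n : S u -> S (u *~ n).
  move=> [y ->]; exists (y *~ n); apply/ffunP => i.
  by rewrite !(ffunE, ffun_mulrzE); ring.
have Siter k i : S (dirac i - dirac (iter k s i)).
  elim: k => [|k IH]; first by rewrite subrr.
  rewrite -[dirac i](subrK (dirac (iter k s i))) -addrA; apply: SD IH _ => /=.
  exists (dirac (s (iter k s i))); apply/ffunP => j.
  by rewrite !ffunE (inj_eq s_inj).
have -> : x = \sum_i (dirac i - dirac (froot s i)) *~ x i.
  suff E : \sum_i dirac (froot s i) *~ x i = 0.
    by rewrite {1}[x]dirac_sum; under [RHS]eq_bigr do rewrite mulrzBl;
      rewrite sumrB E subr0.
  apply/ffunP => r; rewrite sum_ffunE ffunE.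
  pose F i := (r == froot s i)%:R * x i.
  rewrite (eq_bigr F) => [|i _]; last by rewrite ffun_mulrzE ffunE.
  have Fs k : \sum_i F i = \sum_i (r == froot s i)%:R * x (iter k s i).
    elim: k => // k ->; rewrite (reindex_inj s_inj); apply: eq_bigr => i _.
    by rewrite -(fingraph.rootP fs (fconnect1 s i)) -iterSr.
  have : (\sum_i F i) *+ p = 0.
    rewrite -[p in LHS]card_ord -sumr_const (eq_bigr _ (fun k _ => Fs (val k))).
    rewrite exchange_big big1 //= => i _; rewrite -mulr_sumr.
    by have := Nx i; rewrite !ffunE => ->; rewrite mulr0.
  by move/eqP; rewrite mulrn_eq0 eqn0Ngt prime_gt0 //= => /eqP.
elim/big_ind: _ => // i _; apply: SZ.
by have := connect_root (frel s) i => /iter_findex <-.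
Qed.

End CyclicNorm.

(** The trace is additive in 0 -> F^m -> F^n -> F -> 0 (row vectors, with maps
    Phi and psi): a splitting rho of Phi and a vector b with b psi = 1 write
    the identity as rho Phi + psi b. *)
Lemma trace_extension (F : fieldType) m n (Phi : 'M[F]_(m, n)) (psi : 'cV[F]_n)
    (T : 'M[F]_m) (Q : 'M[F]_n) (c : F) :
  row_free Phi -> Phi *m psi = 0 -> psi != 0 ->
  (forall v : 'rV_n, v *m psi = 0 -> (v <= Phi)%MS) ->
  Phi *m Q = T *m Phi -> Q *m psi = c *: psi -> \tr Q = \tr T + c.
Proof.
move=> Phi_free Phi_psi psi0 psi_ker PhiQ Qpsi.
have [j psij] : exists j, psi j 0 != 0.
  apply/existsP; apply: contraR psi0; rewrite negb_exists => /forallP psi0.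
  by apply/eqP/colP => j; rewrite mxE; apply/eqP; have := psi0 j; rewrite negbK.
pose b : 'rV[F]_n := (psi j 0)^-1 *: delta_mx 0 j.
have bpsi : b *m psi = 1%:M.
  apply/matrixP => i k; rewrite !ord1 -scalemxAl -rowE !mxE eqxx.
  by rewrite mulVf.
pose rho := (1%:M - psi *m b) *m pinvmx Phi.
have rhoE : rho *m Phi = 1%:M - psi *m b.
  apply: mulmxKpV; apply/row_subP => i; apply: psi_ker.
  by rewrite -row_mul mulmxBl mul1mx -mulmxA bpsi mulmx1 subrr row0.
have Phi_rho : Phi *m rho = 1%:M.
  apply: (row_free_inj Phi_free).
  by rewrite -mulmxA rhoE mulmxBr mulmx1 mulmxA Phi_psi mul0mx subr0 mul1mx.
have -> : \tr Q = \tr (Q *m rho *m Phi) + \tr (Q *m psi *m b).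
  by rewrite -raddfD /= -[Q *m rho *m Phi]mulmxA -[Q *m psi *m b]mulmxA -mulmxDr rhoE subrK mulmx1.
rewrite mxtrace_mulC mulmxA PhiQ -[T *m Phi *m rho]mulmxA Phi_rho mulmx1; congr (_ + _).
by rewrite Qpsi mxtrace_mulC -scalemxAr bpsi mxtraceZ mxtrace1 mulr1.
Qed.

Section FixedPart.
Variables (gT : finGroupType) (I : finType) (to : {action gT &-> I}).
Variables (p : nat) (sigma : gT).
Hypotheses (p_pr : prime p) (sigmap : (sigma ^+ p = 1)%g).

Definition fixpts : {set I} := [set i | to i sigma == i].
Definition sig (i : I) : I := to i (sigma^-1)%g.
Implicit Types (x y : {ffun I -> int}) (a : I -> 'F_p).

Lemma sig_inj : injective sig. Proof. exact: act_inj. Qed.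

Lemma sig_iter i : iter p sig i = i.
Proof.
have -> k : iter k sig i = to i (sigma^-1 ^+ k)%g.
  by elim: k => [|k IH]; rewrite ?act1 // iterS IH /sig -actM -expgSr.
by rewrite expgVn sigmap invg1 act1.
Qed.

Lemma in_fixpts i : (i \in fixpts) = (sig i == i).
Proof. by rewrite inE /sig (canF_eq (actKV to sigma)) eq_sym. Qed.

Lemma lact_shift (x : permZ to) : lact (permZ to) x sigma = shift sig x.
Proof. by apply/ffunP => i; rewrite !ffunE. Qed.

Lemma norm_shift x : cyclic_norm sig p x = \sum_(k < p) iter k (shift sig) x.
Proof.
apply/ffunP => i; rewrite ffunE sum_ffunE; apply: eq_bigr => k _.
by elim: (k : nat) i => //= m IH i; rewrite ffunE -IH -iterSr.
Qed.

(** The lift to an invariant integral function of a class in H^0 given by its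
    coordinates at the fixed points. *)
Definition fixvec a : {ffun I -> int} :=
  [ffun i => if i \in fixpts then (a i : nat)%:Z else 0].

Lemma fixvec_shift a : shift sig (fixvec a) = fixvec a.
Proof.
apply/ffunP => i; rewrite !ffunE !in_fixpts (inj_eq sig_inj).
by case: eqP => [->|].
Qed.

Lemma fixvec_sum a :
  fixvec a = \sum_(i in fixpts) dirac i *~ (a i : nat)%:Z.
Proof.
rewrite [LHS]dirac_sum [LHS](bigID (mem fixpts)) /= [X in _ + X]big1 ?addr0.
  by apply: eq_bigr => i iF; rewrite ffunE iF.
by move=> i /negPf iF; rewrite ffunE iF.
Qed.

Definition modp (n : int) : 'F_p := n%:~R.

Lemma modp_eq0 n : (modp n == 0) = (p %| n)%Z.
Proof. by rewrite /modp -(dvdz_pcharf (pchar_Fp p_pr)). Qed.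

Lemma modp_nat (c : 'F_p) : modp (c : nat)%:Z = c.
Proof. by rewrite /modp -pmulrn natr_Zp. Qed.

Lemma modp_fixvec a i : i \in fixpts -> modp (fixvec a i) = a i.
Proof. by move=> iF; rewrite ffunE iF modp_nat. Qed.

Lemma modp_norm y i : i \in fixpts -> modp (cyclic_norm sig p y i) = 0.
Proof.
rewrite in_fixpts => /eqP si; rewrite ffunE (eq_bigr (fun=> y i)) => [|k _].
  rewrite sumr_const card_ord; apply/eqP; rewrite modp_eq0 -mulr_natr natz.
  exact: dvdz_mull.
by congr (y _); elim: (k : nat) => //= m ->.
Qed.

Lemma modp0_norm x : shift sig x = x ->
  (forall i, i \in fixpts -> modp (x i) = 0) -> exists y, x = cyclic_norm sig p y.
Proof.
move=> xs xr; apply: (norm_surj p_pr sig_inj sig_iter xs) => i /eqP si.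
by rewrite -modp_eq0 xr // in_fixpts.
Qed.

Lemma fixvec_decomp x : shift sig x = x ->
  exists y, x = fixvec (fun i => modp (x i)) + cyclic_norm sig p y.
Proof.
move=> xs; have [||y yE] := @modp0_norm (x - fixvec (fun i => modp (x i))).
- have /ffunP fs := fixvec_shift (fun i => modp (x i)); move/ffunP: xs => xs.
  by apply/ffunP => i; have := xs i; have := fs i; rewrite !ffunE => -> ->.
- move=> i iF; rewrite /modp ![in X in X%:~R]ffunE rmorphB /= -!/(modp _).
  by rewrite iF modp_nat subrr.
by exists y; rewrite -yE addrC subrK.
Qed.

End FixedPart.

Definition extend_row (p : nat) (A : finType) n (e : 'I_n -> A) (v : 'rV['F_p]_n)
    (i : A) : 'F_p :=
  \sum_c (e c == i)%:R * v 0 c.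

Lemma extend_rowE p (A : finType) n (e : 'I_n -> A) (v : 'rV['F_p]_n) c :
  injective e -> extend_row e v (e c) = v 0 c.
Proof.
move=> e_inj; rewrite /extend_row (bigD1 c) //= eqxx mul1r big1 ?addr0 // => d dc.
by rewrite (inj_eq e_inj) (negPf dc) mul0r.
Qed.

(** * The trace obstruction *)

Section Obstruction.
Variables (gT : finGroupType) (M : glattice gT) (I L : finType).
Variables (toI : {action gT &-> I}) (toL : {action gT &-> L}).
Variables (f : {additive M -> permZ toI}) (h : {additive permZ toI -> permZ toL}).
Hypothesis fh_exact : short_exact f h.
Variables (p : nat) (sigma : gT).
Hypotheses (p_pr : prime p) (sigmap : (sigma ^+ p = 1)%g).
Variable lam : {additive M -> 'F_p}.
(* In cohomological terms: M has no invariants, and lam identifies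
   H^1(<sigma>, M) with F_p. *)
Hypotheses (M_fix : forall u, lact M u sigma = u -> u = 0)
  (lam_sigma : forall u, lam (lact M u sigma) = lam u)
  (lam_ker : forall u, lam u = 0 -> exists w, u = lact M w sigma - w)
  (lam_nz : exists u, lam u != 0).

Local Notation FI := (fixpts toI sigma).
Local Notation FL := (fixpts toL sigma).
Local Notation shI := (shift (sig toI sigma)).
Local Notation shL := (shift (sig toL sigma)).
Local Notation nI := (cyclic_norm (sig toI sigma) p).
Local Notation modp := (@modp p).
Local Notation nL := (cyclic_norm (sig toL sigma) p).

Let fG : equivariant f. Proof. by case: fh_exact. Qed.
Let hG : equivariant h. Proof. by case: fh_exact. Qed.
Let fI : injective f. Proof. by case: fh_exact. Qed.
Let hf u : h (f u) = 0.
Proof. by case: fh_exact => _ _ _ ex _; apply/ex; exists u. Qed.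
Let hker x : h x = 0 -> exists u, x = f u.
Proof. by case: fh_exact => _ _ _ ex _ /ex. Qed.
Let hsurj y : exists x, h x = y. Proof. by case: fh_exact. Qed.

Lemma f_shift u : shI (f u) = f (lact M u sigma).
Proof. by rewrite fG; apply/esym/lact_shift. Qed.

Lemma h_shift x : shL (h x) = h (shI x).
Proof. by rewrite -[shI x](@lact_shift _ _ toI sigma x) hG; apply/esym/lact_shift. Qed.

Lemma shiftB (J : finType) (s : J -> J) x y : shift s (x - y) = shift s x - shift s y.
Proof. by apply/ffunP => i; rewrite !ffunE. Qed.

Lemma h_norm x : h (nI x) = nL (h x).
Proof.
rewrite !norm_shift raddf_sum; apply: eq_bigr => k _.
by elim: (k : nat) => //= m <-; rewrite h_shift.
Qed.

Lemma norm_fixed (J : finType) (to : {action gT &-> J}) x :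
  shift (sig to sigma) (cyclic_norm (sig to sigma) p x) = cyclic_norm (sig to sigma) p x.
Proof.
apply/ffunP => i; rewrite !ffunE.
case: p p_pr sigmap => // n _ sn.
rewrite big_ord_recr [RHS]big_ord_recl /= addrC -iterSr.
rewrite (sig_iter to sn); congr (_ + _); apply: eq_bigr => k _.
by rewrite -iterSr.
Qed.

(** The graph of the connecting homomorphism from the invariants of Z[L] to
    H^1(<sigma>, M) = F_p.  A relation avoids choosing preimages under h. *)
Definition delta_rel (q : permZ toL) (c : 'F_p) : Prop :=
  exists x z, [/\ h x = q, shI x - x = f z & lam z = c].

Lemma delta_uniq q c c' : delta_rel q c -> delta_rel q c' -> c = c'.
Proof.
move=> [x [z [xq xz <-]]] [x' [z' [x'q x'z <-]]].
have [w wE] : exists w, x - x' = f w.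
  by apply: hker; rewrite raddfB xq x'q subrr.
apply/eqP; rewrite -subr_eq0 -raddfB; apply/eqP.
have -> : z - z' = lact M w sigma - w; last by rewrite raddfB lam_sigma subrr.
apply: fI; rewrite !raddfB -xz -x'z -f_shift -wE shiftB.
by rewrite !opprD !opprK addrACA.
Qed.

Lemma deltaD q c q' c' :
  delta_rel q c -> delta_rel q' c' -> delta_rel (q + q') (c + c').
Proof.
move=> [x [z [<- xz <-]]] [x' [z' [<- x'z <-]]].
exists (x + x'), (z + z'); rewrite !raddfD; split=> //.
by rewrite -xz -x'z; apply/ffunP => i; rewrite !ffunE; ring.
Qed.

Lemma delta0 : delta_rel 0 0.
Proof. by exists 0, 0; rewrite !raddf0; split=> //; apply/ffunP => i; rewrite !ffunE. Qed.

Lemma deltaN q c : delta_rel q c -> delta_rel (- q) (- c).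
Proof.
move=> [x [z [<- xz <-]]]; exists (- x), (- z); rewrite !raddfN -xz; split=> //.
by apply/ffunP => i; rewrite !ffunE; ring.
Qed.

Lemma deltaZ q c n : delta_rel q c -> delta_rel (q *~ n) (c *~ n).
Proof.
move=> qc; have nat_case (k : nat) : delta_rel (q *+ k) (c *+ k).
  by elim: k => [|k IH]; [apply: delta0 | rewrite !mulrS; apply: deltaD].
case: n => n; first by rewrite -!pmulrn.
by rewrite NegzE !mulrNz -!pmulrn; apply: deltaN.
Qed.

Lemma delta_sum (A : finType) (P : pred A) (q : A -> permZ toL) c :
  (forall a, P a -> delta_rel (q a) (c a)) ->
  delta_rel (\sum_(a | P a) q a) (\sum_(a | P a) c a).
Proof.
move=> qc; elim/big_rec2: _ => [|a c' q' Pa]; first exact: delta0.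
by apply: deltaD; apply: qc.
Qed.

Lemma delta_fixed x : shI x = x -> delta_rel (h x) 0.
Proof. by move=> xs; exists x, 0; rewrite xs subrr !raddf0. Qed.

Lemma delta_norm q : delta_rel (nL q) 0.
Proof.
have [x <-] := hsurj q; rewrite -h_norm; apply: delta_fixed; exact: norm_fixed.
Qed.

Lemma delta_ex q : shL q = q -> exists c, delta_rel q c.
Proof.
have [x <-] := hsurj q => xq; have [z zE] : exists z, shI x - x = f z.
  by apply: hker; rewrite raddfB -h_shift xq subrr.
by exists (lam z), x, z.
Qed.

Lemma delta_eq0 q : delta_rel q 0 -> exists x, shI x = x /\ h x = q.
Proof.
move=> [x [z [<- xz /lam_ker[w wE]]]]; exists (x - f w); split.
  rewrite shiftB f_shift; apply/eqP; rewrite -subr_eq0 opprD opprK addrACA.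
  by rewrite xz wE raddfB /= addrACA subrr addNr addr0.
by rewrite raddfB hf subr0.
Qed.

(** A class z with lam z nonzero is hit because H^1(<sigma>, Z[I]) = 0: the
    norm of f z is the image of an invariant of M, so it vanishes. *)
Lemma delta_nontrivial : exists q c, [/\ shL q = q, delta_rel q c & c != 0].
Proof.
have [z zn] := lam_nz; have [x xz] : exists x, f z = shI x - x.
  apply: (norm_ker p_pr (@sig_inj _ _ toI sigma)).
  have : shI (nI (f z)) = nI (f z) by exact: norm_fixed.
  have [w ->] : exists w, nI (f z) = f w.
    apply: hker; rewrite h_norm hf; apply/ffunP => i; rewrite !ffunE big1 // => k _.
    by rewrite ffunE.
  by rewrite f_shift => /fI/M_fix->; rewrite raddf0.
exists (h x), (lam z); split=> //; last by exists x, z.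
by apply/eqP; rewrite h_shift -subr_eq0 -raddfB /= -xz hf.
Qed.

(** This is the injectivity of H^0(Z[I]) -> H^0(Z[L]), which holds as M has no
    invariants. *)
Lemma norm_lift x q : shI x = x -> h x = nL q -> exists y, x = nI y.
Proof.
have [y <-] := hsurj q => xs; rewrite -h_norm => hxy.
have [u uE] : exists u, x - nI y = f u by apply: hker; rewrite raddfB hxy subrr.
exists y; apply/eqP; rewrite -subr_eq0 uE (@M_fix u) ?raddf0 //.
by apply: fI; rewrite -f_shift -uE shiftB xs norm_fixed.
Qed.

Section Normaliser.
Variables (rho : gT) (m : nat).
Hypothesis rho_sigma : (rho * sigma = sigma ^+ m * rho)%g.
Hypothesis lam_rho : forall u, lam (lact M u rho) = lam u.

(** The element rho acts on the line H^1(<sigma>, M) as m: the cocycle of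
    x rho at sigma is that of x at sigma^m, transported by rho. *)
Lemma delta_rho q c : delta_rel q c -> delta_rel (lact _ q rho) (c *+ m).
Proof.
move=> [x [z [<- xz <-]]].
have [w [wE lw]] : exists w, lact _ x (sigma ^+ m)%g - x = f w /\ lam w = lam z *+ m.
  elim: m => [|k [w [wE lw]]].
    by exists 0; rewrite expg0 tact1 subrr !raddf0.
  exists (lact M w sigma + z); split; last by rewrite raddfD /= lam_sigma lw mulrSr.
  rewrite raddfD -xz -f_shift -wE shiftB expgSr tactM.
  by rewrite -(lact_shift (to := toI)) addrA subrK.
exists (lact _ x rho), (lact M w rho); rewrite hG lam_rho lw; split=> //.
rewrite -(lact_shift (to := toI)) -tactM rho_sigma tactM fG -wE.
by apply: esym; exact: (@lact_atB _ (permZ toI) rho).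
Qed.

Lemma fixpts_rho (J : finType) (to : {action gT &-> J}) i :
  (to i rho \in fixpts to sigma) = (i \in fixpts to sigma).
Proof.
suff H j : j \in fixpts to sigma -> to j rho \in fixpts to sigma.
  apply/idP/idP => [|]; last exact: H.
  have rhoK k : iter k (to^~ rho) i = to i (rho ^+ k)%g.
    by elim: k => [|k IH]; rewrite ?tact1 // iterS IH -tactM -expgSr.
  have iE : i = iter #[rho]%g.-1 (to^~ rho) (to i rho).
    rewrite -iterSr prednK ?fingroup.order_gt0 // rhoK expg_order tact1 //.
  move=> iF; rewrite iE; elim: (_.-1) => //= k; exact: H.
rewrite !inE => /eqP js; rewrite -tactM rho_sigma tactM.
suff -> : to j (sigma ^+ m)%g = j by [].
by elim: m => [|k IH]; rewrite ?tact1 // expgSr tactM IH.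
Qed.

Definition fixcount (J : finType) (to : {action gT &-> J}) : nat :=
  #|[set i in fixpts to sigma | to i rho == i]|.


Lemma fixcount_trace (J : finType) (to : {action gT &-> J}) :
  let e (a : 'I_#|fixpts to sigma|) := enum_val a in
  \tr (\matrix_(a, b) (to (e a) rho == e b)%:R : 'M['F_p]__) = (fixcount to)%:R.
Proof.
move=> e; rewrite /mxtrace; under eq_bigr do rewrite mxE.
transitivity (\sum_(i in fixpts to sigma) (to i rho == i)%:R : 'F_p).
  by rewrite [RHS]big_enum_val; apply: eq_bigr.
rewrite /fixcount -sum1_card natr_sum big_mkcond [RHS]big_mkcond /=.
by apply: eq_bigr => i _; rewrite !inE; case: eqP; case: eqP.
Qed.

(** The matrices of h and of the connecting homomorphism in the coordinates at
    the fixed points form an exact sequence of F_p-spaces on which rho acts by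
    permutation matrices, and by m on the quotient. *)
Lemma fixcount_eq : (fixcount toL)%:R = (fixcount toI)%:R + m%:R :> 'F_p.
Proof.
have [psi psiE] : exists psi : L -> 'F_p,
    forall k, k \in FL -> delta_rel (dirac k) (psi k).
  apply: (@fin_all_exists _ _ (fun k c => k \in FL -> delta_rel (dirac k) c)) => k.
  have [kF|//] := boolP (k \in FL); last by exists 0.
  have [c cP] : exists c, delta_rel (dirac k) c; last by exists c.
  apply: delta_ex; rewrite -(lact_shift (to := toL)) dirac_act.
  by move: kF; rewrite inE => /eqP ->.
have psi_fixvec a : delta_rel (fixvec toL sigma a) (\sum_(k in FL) a k * psi k).
  rewrite fixvec_sum (eq_bigr (fun k => psi k *~ (a k : nat)%:Z)).
    by apply: delta_sum => k kF; apply: deltaZ; apply: psiE.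
  by move=> k _; rewrite -mulrzr mulrC -[(_)%:~R]/(modp _) modp_nat.
have psi_sum q : shL q = q -> delta_rel q (\sum_(k in FL) modp (q k) * psi k).
  move=> qs; have [y {1}->] := fixvec_decomp p_pr sigmap qs.
  by rewrite -[X in delta_rel _ X]addr0; apply: deltaD (delta_norm y).
have fix_dirac i : i \in FI -> shI (dirac i) = dirac i.
  by move=> iF; rewrite -(lact_shift (to := toI)) dirac_act; move: iF; rewrite inE => /eqP ->.
pose eI (a : 'I_#|FI|) := enum_val a; pose eL (a : 'I_#|FL|) := enum_val a.
have eIP a : eI a \in FI by exact: enum_valP.
have eLP a : eL a \in FL by exact: enum_valP.
have sumI (F : I -> 'F_p) : \sum_a F (eI a) = \sum_(i in FI) F i.
  by rewrite -big_enum_val.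
have sumL (F : L -> 'F_p) : \sum_a F (eL a) = \sum_(i in FL) F i.
  by rewrite -big_enum_val.
pose Phi : 'M['F_p]_(#|FI|, #|FL|) := \matrix_(a, b) modp (h (dirac (eI a)) (eL b)).
pose Psi : 'cV['F_p]_#|FL| := \col_b psi (eL b).
have eI_inj : injective eI by exact: enum_val_inj.
have eL_inj : injective eL by exact: enum_val_inj.
have h_fixvec v b : modp (h (fixvec toI sigma (extend_row eI v)) (eL b)) = (v *m Phi) 0 b.
  transitivity (\sum_(i in FI) extend_row eI v i * modp (h (dirac i) (eL b))).
    rewrite fixvec_sum raddf_sum sum_ffunE /modp rmorph_sum /=.
    apply: eq_bigr => i _; rewrite raddfMz ffun_mulrzE rmorphM /= mulrC.
    by rewrite -[(_ : nat)%:~R]/(modp _) modp_nat.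
  by rewrite -sumI mxE; apply: eq_bigr => c _; rewrite extend_rowE // mxE.
rewrite -!fixcount_trace; apply: (@trace_extension _ _ _ Phi Psi).
- apply: inj_row_free => v vPhi; pose x := fixvec toI sigma (extend_row eI v).
  have xs : shI x = x by exact: fixvec_shift.
  have [|b bF|q hq] := @modp0_norm _ _ toL _ _ p_pr sigmap (h x).
  - by rewrite h_shift xs.
  - rewrite -(enum_rankK_in bF bF); set b' := enum_rank_in _ _.
    by rewrite -/(eL b') h_fixvec vPhi mxE.
  have [y xy] := norm_lift xs hq; apply/rowP => a; rewrite [RHS]mxE.
  rewrite -(extend_rowE v a eI_inj) -(modp_fixvec (extend_row eI v) (eIP a)) -/x xy.
  exact: modp_norm.
- apply/matrixP => a j; rewrite !mxE ord1.
  transitivity (\sum_(k in FL) modp (h (dirac (eI a)) k) * psi k).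
    by rewrite -sumL; apply: eq_bigr => b _; rewrite !mxE.
  have hs : shL (h (dirac (eI a))) = h (dirac (eI a)) by rewrite h_shift fix_dirac.
  by apply: delta_uniq (psi_sum _ hs) _; apply: delta_fixed; apply: fix_dirac.
- apply/eqP => /colP psi0; have [q [c [qs qc /negP[]]]] := delta_nontrivial.
  rewrite (delta_uniq qc (psi_sum q qs)) -sumL big1 // => b _.
  by have := psi0 b; rewrite !mxE => ->; rewrite mulr0.
- move=> v vpsi; pose q := fixvec toL sigma (extend_row eL v).
  have qv : \sum_(k in FL) extend_row eL v k * psi k = 0.
    have /rowP/(_ 0) := vpsi; rewrite mxE [RHS]mxE; apply: etrans.
    by rewrite -sumL; apply: eq_bigr => b _; rewrite extend_rowE // mxE.
  have := psi_fixvec (extend_row eL v); rewrite qv => /delta_eq0[x [xs hx]].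
  have [y xE] := fixvec_decomp p_pr sigmap xs.
  apply/submxP; exists (\row_a modp (x (eI a))); apply/rowP => b.
  rewrite -[LHS](extend_rowE _ _ eL_inj) -(modp_fixvec (extend_row eL v) (eLP b)) -hx {1}xE raddfD.
  rewrite ffunE /modp rmorphD /= -!/(modp _) h_norm.
  rewrite (modp_norm p_pr _ (eLP b)) addr0.
  rewrite -h_fixvec; congr (modp (h _ _)); apply/ffunP => i; rewrite !ffunE.
  case: ifP => // iF; rewrite -(enum_rankK_in iF iF); set i' := enum_rank_in _ _.
  by rewrite -/(eI i') extend_rowE // mxE.
- apply/matrixP => a b; rewrite !mxE.
  transitivity (modp (h (dirac (eI a)) (toL (eL b) rho^-1)%g)).
    transitivity (\sum_(k in FL) modp (h (dirac (eI a)) k) * (toL k rho == eL b)%:R).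
      by rewrite -sumL; apply: eq_bigr => c _; rewrite !mxE.
    have kF : toL (eL b) rho^-1%g \in FL by rewrite -fixpts_rho actKV.
    rewrite (bigD1 _ kF) /= actKV eqxx mulr1 big1 ?addr0 // => k /andP[_ kb].
    case: eqP => [E|_]; last by rewrite mulr0.
    by move: kb; rewrite -E actK eqxx.
  transitivity (\sum_(i in FI) (toI (eI a) rho == i)%:R * modp (h (dirac i) (eL b))).
    have iF : toI (eI a) rho \in FI by rewrite fixpts_rho.
    rewrite (bigD1 _ iF) /= eqxx mul1r big1 ?addr0 => [|i /andP[_]].
      by rewrite -dirac_act hG permZ_lact.
    by rewrite eq_sym => /negPf ->; rewrite mul0r.
  by rewrite -sumI; apply: eq_bigr => c _; rewrite !mxE.
apply/colP => a; rewrite !mxE.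
transitivity (\sum_(k in FL) (toL (eL a) rho == k)%:R * psi k).
  by rewrite -sumL; apply: eq_bigr => c _; rewrite !mxE.
have kF : toL (eL a) rho \in FL by rewrite fixpts_rho.
rewrite (bigD1 _ kF) /= eqxx mul1r big1 ?addr0 => [|i /andP[_]]; last first.
  by rewrite eq_sym => /negPf ->; rewrite mul0r.
have := delta_rho (psiE _ (eLP a)); rewrite dirac_act => /(delta_uniq (psiE _ kF)) ->.
by rewrite mulr_natl.
Qed.

End Normaliser.
End Obstruction.

(** * The symmetric group of prime degree p > 3 *)

Section Degree.
Variables (p : nat) (x0 : 'I_p).
Hypothesis p_pr : prime p.
Local Notation actP := ('P%act : {action 'S_p &-> 'I_p}).
Local Notation J := (J_sign actP).
Local Notation mk := (mkJ actP).

Definition left_elt (s : 'S_p) : timesC2 'S_p := (s, 1%g).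

Lemma left_eltM s t : (left_elt s * left_elt t)%g = left_elt (s * t)%g.
Proof. exact: (congr1 (pair (s * t)%g) (mulg1 _)). Qed.

Lemma mkJ_left a s :
  lact J (mk a) (left_elt s) = mk [ffun i => a (s^-1%g i)].
Proof.
rewrite mkJ_act /left_sign ifT ?mulr1z; last by rewrite inE /= !inE eqxx.
by congr mk; apply/ffunP => i; rewrite !ffunE.
Qed.

(** The sum of the coefficients is defined on J modulo p only, constants having
    degree a multiple of p; on differences a i - a x0 it reads as below. *)
Definition degree (u : J) : 'F_p := \sum_i (jdiff u (i, x0))%:~R.

Lemma degreeB : {morph degree : u v / u - v}.
Proof.
move=> u v; rewrite /degree -sumrB; apply: eq_bigr => i _.
by rewrite raddfB !ffunE rmorphB.
Qed.
HB.instance Definition _ := GRing.isZmodMorphism.Build J 'F_p degree degreeB.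

Lemma degree_mk a : degree (mk a) = \sum_i (a i)%:~R.
Proof.
rewrite /degree; under eq_bigr do rewrite jdiff_mk rmorphB /=.
rewrite sumrB sumr_const card_ord -mulr_natr.
by rewrite (pcharf0 (pchar_Fp p_pr)) mulr0 subr0.
Qed.

Lemma degree_left u s : degree (lact J u (left_elt s)) = degree u.
Proof.
have [a ->] := mkJ_surj u; rewrite mkJ_left !degree_mk.
rewrite (reindex_inj (@perm_inj _ s)); apply: eq_bigr => i _.
by rewrite ffunE permK.
Qed.

Local Notation sigma := (left_elt (rotation p)).

Lemma sigma_exp k : (sigma ^+ k)%g = left_elt (rotation p ^+ k)%g.
Proof.
elim: k => [|k IH]; first by rewrite !expg0.
by rewrite !expgSr IH left_eltM.
Qed.

Lemma rotation_const (T : Type) (a : 'I_p -> T) :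
  (forall i, a (rotation p i) = a i) -> forall i j, a i = a j.
Proof.
move=> ar i j; have [_ /(_ i j)/iter_findex <-] := rotation_cyclic p.
by elim: (findex _ _ _) => //= k IH; rewrite ar.
Qed.

(** If a is invariant up to a constant, this constant is zero, since it sums to
    zero over X; so a is constant along the only cycle. *)
Lemma J_sigma_fixed u : lact J u sigma = u -> u = 0.
Proof.
have [a ->] := mkJ_surj u; rewrite mkJ_left => E.
pose d i : int := a ((rotation p)^-1%g i) - a i.
have dE i j : d i = d j.
  have := jdiff_mk actP a (i, j); rewrite -E jdiff_mk !ffunE /= => E'.
  rewrite /d -[X in X - _ = _](subrK (a ((rotation p)^-1%g j))) E'; ring.
have d0 i : d i = 0.
  have : \sum_j d j = 0.
    rewrite sumrB (reindex_inj (@perm_inj _ (rotation p))) /=.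
    by under eq_bigr do rewrite permK; rewrite subrr.
  rewrite (eq_bigr (fun=> d i)) => [|j _]; last exact: dE.
  rewrite sumr_const card_ord => /eqP.
  by rewrite mulrn_eq0 eqn0Ngt prime_gt0 //= => /eqP.
have ac := @rotation_const _ a _; rewrite -(mkJ_const actP (a x0)); congr mk.
apply/ffunP => i; rewrite ffunE; apply: ac => j.
by have /eqP := d0 (rotation p j); rewrite /d permK subr_eq0 => /eqP.
Qed.

(** Modulo the elements w sigma - w all basis vectors are equivalent, so a
    function of degree p k is equivalent to p k times a basis vector, hence to
    k times the sum of all of them, which is zero in J. *)
Lemma degree_ker u : degree u = 0 -> exists w, u = lact J w sigma - w.
Proof.
pose S v := exists w, v = lact J w sigma - w.
have SN v : S v -> S (- v).
  move=> [w ->]; exists (- w).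
  by rewrite -/(lact_at sigma (- w)) raddfN /= /lact_at opprB addrC opprK.
have SD v v' : S v -> S v' -> S (v + v').
  by move=> [w ->] [w' ->]; exists (w + w'); rewrite lactD opprD addrACA.
have S0 : S 0 by exists 0; rewrite -/(lact_at sigma 0) raddf0 subrr.
have SZ v n : S v -> S (v *~ n).
  move=> Sv; have nat_case (k : nat) : S (v *+ k).
    by elim: k => [|k IH]; rewrite ?mulr0n // mulrS; apply: SD.
  case: n => n; first by rewrite -pmulrn.
  by rewrite NegzE mulrNz -pmulrn; apply: SN.
have Ssum (A : finType) (P : pred A) (F : A -> J) :
    (forall i, P i -> S (F i)) -> S (\sum_(i | P i) F i).
  by move=> FS; elim/big_ind: _.
have Sd i : S (mk (dirac i) - mk (dirac x0)).
  have [_ /(_ x0 i)/iter_findex <-] := rotation_cyclic p.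
  elim: (findex _ _ _) => [|k IH]; first by rewrite subrr.
  rewrite -[mk _](subrK (mk (dirac (iter k (rotation p) x0)))) -addrA; apply: SD IH.
  exists (mk (dirac (iter k (rotation p) x0))); rewrite mkJ_left; congr (mk _ - _).
  apply/ffunP => j; rewrite !ffunE /=.
  by rewrite -(inj_eq (@perm_inj _ (rotation p)) _ (iter _ _ _)) permKV.
have [a ->] := mkJ_surj u; rewrite degree_mk => a0.
have /dvdzP[k kE] : (p %| \sum_i a i)%Z.
  by rewrite (dvdz_pcharf (pchar_Fp p_pr)) rmorph_sum; apply/eqP.
change (S (mk a)); have -> : mk a = \sum_i (mk (dirac i) - mk (dirac x0)) *~ a i
    - (\sum_i (mk (dirac i) - mk (dirac x0))) *~ k.
  have c0 : \sum_i mk (dirac i) = 0.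
    rewrite -raddf_sum -(mkJ_const actP 1); congr mk.
    apply/ffunP => i; rewrite sum_ffunE ffunE (bigD1 i) //= ffunE eqxx big1 ?addr0 //.
    by move=> j ji; rewrite ffunE eq_sym (negPf ji).
  rewrite sumrB c0 sub0r sumr_const card_ord mulNrz opprK.
  rewrite (eq_bigr _ (fun i _ => mulrzBl _ _ _)) sumrB -mulrz_sumr kE.
  rewrite [k * _]mulrC mulrzA -pmulrn subrK {1}[a]dirac_sum raddf_sum.
  by apply: eq_bigr => i _; rewrite raddfMz.
by apply: SD; [|apply/SN/SZ]; apply: Ssum => i _; rewrite //; apply: SZ.
Qed.

End Degree.

Section Doubling.
Variable p : nat.

Lemma double_ord_proof (x : 'I_p) : (x.*2 %% p < p)%N.
Proof. by rewrite ltn_mod (leq_trans _ (ltn_ord x)). Qed.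
Definition double_ord (x : 'I_p) : 'I_p := Ordinal (double_ord_proof x).

Hypothesis p_odd : odd p.

Lemma double_ord_inj : injective double_ord.
Proof.
move=> x y /(congr1 val)/= /eqP; rewrite -!muln2 => E; apply: val_inj => /=.
move: E; wlog xy : x y / (x <= y)%N.
  by move=> W; case/orP: (leq_total x y) => ?; [|rewrite eq_sym => /W->//]; apply: W.
rewrite eq_sym eqn_mod_dvd ?leq_mul2r ?xy ?orbT // -mulnBl Gauss_dvdl; last first.
  by rewrite coprimen2.
move/dvdn_leq => H; apply/eqP; rewrite eqn_leq xy /= leqNgt; apply/negP => lt.
by have := H; rewrite subn_gt0 => /(_ lt); have := ltn_ord y; lia.
Qed.

Definition doubling : 'S_p := perm double_ord_inj.

Lemma rotation_doubling :
  (rotation p * doubling = doubling * rotation p ^+ 2)%g.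
Proof.
apply/permP => x; apply: val_inj; rewrite [in LHS]permM [in RHS]permM /= rotation_iter !permE /=.
by rewrite modnDml -!muln2 modnMml; congr (_ %% _)%N; lia.
Qed.

Lemma doubling_rotation :
  (doubling * rotation p = rotation p ^+ p.+1./2 * doubling)%g.
Proof.
apply/permP => x; apply: val_inj; rewrite !permM !permE /=.
rewrite rotation_iter -!muln2 modnMml.
have -> : ((x + p.+1./2) * 2 = x * 2 + 1 + p)%N.
  have := odd_double_half p; rewrite p_odd /=; have := uphalf_half p.
  by rewrite p_odd -muln2; lia.
by rewrite modnDr -addn1 modnDml.
Qed.

End Doubling.

(** The trace identity holds for d^-1 with the factor 2, and for d with the
    factor (p + 1) / 2, the inverse of 2.  Fixed points do not distinguish d
    from d^-1. *)
Theorem J_sign_not_quasi_permutation (p : nat) : prime p -> (5 <= p)%N ->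
  ~ quasi_permutation (J_sign ('P : {action 'S_p &-> 'I_p})).
Proof.
move=> p_pr p5 /quasi_permutation_form[I [L [toI [toL [f [h fh]]]]]].
have p_odd : odd p by case/even_prime: p_pr p5 => [->|].
pose x0 : 'I_p := Ordinal (prime_gt0 p_pr).
pose s := left_elt (rotation p).
pose d := left_elt (doubling p_odd).
have sp : (s ^+ p = 1)%g by rewrite sigma_exp rotation_exp.
have lam1 : exists u, degree x0 u != 0.
  exists (mkJ _ (dirac x0)); rewrite degree_mk // (bigD1 x0) //= ffunE eqxx.
  by rewrite big1 ?addr0 ?oner_eq0 // => i /negPf ix; rewrite ffunE ix.
have count rho m : (rho * s = s ^+ m * rho)%g ->
    (forall u, degree x0 (lact _ u rho) = degree x0 u) ->
    (fixcount s rho toL)%:R = (fixcount s rho toI)%:R + m%:R :> 'F_p.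
  move=> rs rd; apply: (fixcount_eq fh p_pr sp (lam := degree x0)) => //.
  - exact: J_sigma_fixed.
  - by move=> u; apply: degree_left.
  by move=> u; apply: degree_ker.
have sd : (s * d = d * s ^+ 2)%g.
  by rewrite sigma_exp !left_eltM rotation_doubling.
have ds : (d * s = s ^+ p.+1./2 * d)%g.
  by rewrite sigma_exp !left_eltM doubling_rotation.
have dVs : (d^-1 * s = s ^+ 2 * d^-1)%g.
  by apply: (mulgI d); rewrite mulgA mulgV mul1g mulgA -sd mulgK.
have fixV (J : finType) (to : {action _ &-> J}) : fixcount s d^-1%g to = fixcount s d to.
  apply: eq_card => i; rewrite !inE; congr (_ && _).
  by rewrite [LHS](canF_eq (actKV to d)) eq_sym.
have dV : (d^-1)%g = left_elt (doubling p_odd)^-1.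
  by apply: (mulgI d); rewrite mulgV left_eltM mulgV.
have E1 := count _ _ dVs (fun u => etrans (congr1 (fun g => degree x0 (lact _ u g)) dV)
  (degree_left x0 p_pr u _)).
have E2 := count _ _ ds (fun u => degree_left x0 p_pr u _).
move: E1; rewrite !fixV E2 => /addrI E.
(* E says (p + 1) / 2 = 2 in F_p; doubled, this is 1 = 4. *)
have p1 : (p.+1./2 * 2 = p + 1)%N.
  by have := odd_double_half p; have := uphalf_half p; rewrite p_odd -muln2; lia.
have : (3%:R : 'F_p) = 0.
  have := congr1 (fun c : 'F_p => c * 2%:R) E.
  rewrite -!natrM p1 natrD (pcharf0 (pchar_Fp p_pr)) add0r => /esym E4.
  by apply: (addIr (1 : 'F_p)); rewrite add0r -[RHS]E4 natr1.
move/eqP; rewrite -(dvdn_pcharf (pchar_Fp p_pr)) => /dvdn_leq; lia.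
Qed.

(** * A unimodular matrix for A_5 *)

(** The orbits of 0 under the twelve elements of the class of the 5-cycle
    0 1 2 3 4 in A_5; entry m + 6 is the inverse of entry m. *)
Definition cycle_table : seq (seq nat) :=
  [:: [:: 0; 1; 2; 3; 4]; [:: 0; 1; 3; 4; 2]; [:: 0; 1; 4; 2; 3];
      [:: 0; 2; 1; 4; 3]; [:: 0; 2; 3; 1; 4]; [:: 0; 3; 1; 2; 4];
      [:: 0; 4; 3; 2; 1]; [:: 0; 2; 4; 3; 1]; [:: 0; 3; 2; 4; 1];
      [:: 0; 3; 4; 1; 2]; [:: 0; 4; 1; 3; 2]; [:: 0; 4; 2; 1; 3]]%N.

(** Permutations whose squares conjugate the first cycle to the others.
    Squares serve because they are visibly even. *)
Definition conj_table : seq (seq nat) :=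
  [:: [:: 0; 1; 2; 3; 4]; [:: 0; 1; 4; 2; 3]; [:: 0; 1; 3; 4; 2];
      [:: 0; 3; 4; 2; 1]; [:: 0; 3; 1; 2; 4]; [:: 0; 2; 3; 1; 4];
      [:: 0; 2; 4; 1; 3]; [:: 0; 4; 1; 3; 2]; [:: 0; 4; 2; 1; 3];
      [:: 0; 2; 3; 4; 1]; [:: 0; 2; 4; 3; 1]; [:: 0; 3; 2; 4; 1]]%N.

Definition pair_table : seq (nat * nat) :=
  [:: (0, 0); (0, 1); (0, 2); (0, 3); (0, 4); (1, 1); (1, 2); (1, 3); (1, 4);
      (2, 2); (2, 3); (2, 4); (3, 3); (3, 4); (4, 4)]%N.

Definition pos (k i : nat) : nat := index i (nth [::] cycle_table k).
Definition cyc (k i : nat) : nat :=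
  nth 0%N (nth [::] cycle_table k) ((pos k i).+1 %% 5).
Definition conj5 (k i : nat) : nat := nth 0%N (nth [::] conj_table k) i.
Definition edge_of (m a b : nat) : bool := (cyc m a == b) || (cyc m b == a).

(** Numerical codes for the two permutation bases: cycles and unordered pairs
    on one side, ordered pairs and pentagons on the other. *)
Definition codeL : eqType := (nat + nat)%type.
Definition codeI : eqType := (nat * nat + nat)%type.
Definition codesL : seq codeL :=
  [seq inl k | k <- iota 0 12] ++ [seq inr e | e <- iota 0 15].
Definition codesI : seq codeI :=
  [seq inl ij | ij <- allpairs pair (iota 0 5) (iota 0 5)]
    ++ [seq inr m | m <- iota 0 6].

(** The map h adds the coordinates along a cycle and over an unordered pair.
    On its own this is not onto; each pentagon contributes 2 to its two
    orientations and -2 to the other cycles, 1 to its edges and -2 to the other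
    pairs.  With these values h is onto and its kernel is J. *)
Definition Hcode (l : codeL) (c : codeI) : int :=
  match l, c with
  | inl k, inl (i, j) => (cyc k i == j)%:R
  | inl k, inr m => if (k %% 6 == m)%N then 2 else -2
  | inr e, inl (i, j) => let: (a, b) := nth (0, 0)%N pair_table e in
      ((i == a) && (j == b) || (i == b) && (j == a))%:R
  | inr e, inr m => let: (a, b) := nth (0, 0)%N pair_table e in
      if edge_of m a b then 1 else -2
  end.

(** The right inverse is natural modulo J.  The image of a cycle c combines
    the cut of c at the edge entering 0 with the sums of the (i, c^k i) and
    with the pentagon of c; the image of a pair {a, b} with a <> b combines the
    ordered pairs that leave it, its own two orderings, the pairs (i, i), and
    the pentagons of which it is an edge.  The coefficients are the solution of
    the linear system h r = 1 in this form. *)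
Definition Rcode (l : codeL) (c : codeI) : int :=
  match l, c with
  | inl k, inl (i, j) => 3 * (pos k j < pos k i)%N%:R - 2 * (cyc k (cyc k i) == j)%:R
      - 3 * (cyc k (cyc k (cyc k i)) == j)%:R
      - 2 * (cyc k (cyc k (cyc k (cyc k i))) == j)%:R - 2 * (i == j)%:R
  | inl k, inr m => - (k %% 6 == m)%N%:R
  | inr e, inl (i, j) => let: (a, b) := nth (0, 0)%N pair_table e in
      if a == b then ((i == a) && (j == a))%:R else
      3 * ((i \in [:: a; b]) && (j \notin [:: a; b]))%:R + 6 * (i == j)%:R
      - ((i == a) && (j == b) || (i == b) && (j == a))%:R
  | inr e, inr m => let: (a, b) := nth (0, 0)%N pair_table e in
      (edge_of m a b)%:R
  end.

(** Unlike the big operators, this sum reduces by computation. *)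
Fixpoint sumz (T : Type) (F : T -> int) (s : seq T) : int :=
  if s is x :: s' then F x + sumz F s' else 0.

Lemma sumzE (T : Type) (F : T -> int) s : \sum_(x <- s) F x = sumz F s.
Proof. by elim: s => [|x s IH]; rewrite ?big_nil // big_cons IH. Qed.

Definition Dcode (c d : codeI) : int :=
  sumz (fun l => Rcode l d * Hcode l c) codesL - (d == c)%:R.

Lemma check_right_inverse :
  all (fun l => all (fun l' =>
    sumz (fun c => Hcode l c * Rcode l' c) codesI == (l == l')%:R) codesL) codesL.
Proof. by vm_compute. Qed.

(** The columns of r h - 1 are difference functions on the ordered pairs, and
    vanish on the pentagons: r h = 1 modulo J. *)
Lemma check_left_inverse :
  all (fun c => all (fun d => match d with
    | inl (i, j) => Dcode c d == Dcode c (inl (i, 0%N)) - Dcode c (inl (j, 0%N))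
    | inr _ => Dcode c d == 0
    end) codesI) codesI.
Proof. by vm_compute. Qed.

(** * The sets of cycles, pentagons and edges of A_5 *)

Section SubAction.
Variables (gT : finGroupType) (T : finType) (to : {action gT &-> T}) (A : {set T}).
Hypothesis AP : forall x g, x \in A -> to x g \in A.

Definition sub_act (x : {x | x \in A}) (g : gT) : {x | x \in A} :=
  exist _ (to (val x) g) (AP g (valP x)).

Lemma sub_act1 x : sub_act x 1%g = x.
Proof. by apply: val_inj; apply: act1. Qed.

Lemma sub_actM x g h : sub_act x (g * h)%g = sub_act (sub_act x g) h.
Proof. by apply: val_inj; apply: actM. Qed.

Definition sub_action : {action gT &-> {x | x \in A}} :=
  TotalAction sub_act1 sub_actM.

End SubAction.

Lemma eq_set2 (T : finType) (i j a b : T) :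
  ([set i; j] == [set a; b]) = (i == a) && (j == b) || (i == b) && (j == a).
Proof.
apply/eqP/idP => [/setP E|]; last first.
  by case/orP => /andP[/eqP-> /eqP->] //; rewrite setUC.
have := E i; have := E j; have := E a; have := E b; rewrite !inE !eqxx !orbT /=.
move=> /orP Eb /orP Ea /esym/orP Ej /esym/orP[/eqP ia|/eqP ib].
  subst a; rewrite eqxx /=; case: Eb => /eqP b_; last by rewrite b_ eqxx.
  by subst b; case: Ej => /eqP ->; rewrite eqxx.
subst b; rewrite eqxx orbC /=; case: Ea => /eqP a_; last by rewrite a_ eqxx.
by subst a; case: Ej => /eqP ->; rewrite eqxx.
Qed.

Section CycleTables.

Definition conj_fun k (i : 'I_5) : 'I_5 := inord (conj5 k i).

(** For k >= 12 the table gives no permutation, and the value is 1. *)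
Definition conj_perm k : 'S_5 :=
  if @idP (injectiveb (conj_fun k)) is ReflectT h
  then perm (elimT (injectiveP _) h) else 1%g.

Lemma conj_permE k (i : 'I_5) : (k < 12)%N -> conj_perm k i = conj5 k i :> nat.
Proof.
move=> k12.
have conj_lt j : (j < 5)%N -> (conj5 k j < 5)%N.
  have /allP/(_ k) : all (fun k => all (fun j => (conj5 k j < 5)%N) (iota 0 5)) (iota 0 12).
    by vm_compute.
  by rewrite mem_iota => /(_ k12)/allP jP j5; apply: jP; rewrite mem_iota.
rewrite /conj_perm; case: {-}_ / idP => [h|[]]; first by rewrite permE /= inordK // conj_lt.
apply/injectiveP => i1 i2 /(congr1 val); rewrite /= !inordK ?conj_lt // => E.
have /allP/(_ k) : all (fun k => all (fun j => all (fun j' =>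
    (conj5 k j == conj5 k j') ==> (j == j')) (iota 0 5)) (iota 0 5)) (iota 0 12).
  by vm_compute.
rewrite mem_iota => /(_ k12)/allP/(_ i1); rewrite mem_iota => /(_ (ltn_ord i1)).
move/allP/(_ i2); rewrite mem_iota => /(_ (ltn_ord i2)).
by rewrite E eqxx => /eqP; apply: val_inj.
Qed.

Definition five_cycles : {set 'S_5} := (rotation 5 ^: 'Alt_('I_5))%g.

Definition cycle_perm k : 'S_5 := (rotation 5 ^ (conj_perm k ^+ 2))%g.

Lemma cycle_perm_in k : cycle_perm k \in five_cycles.
Proof.
by apply: imset_f; rewrite Alt_even expgS expg1 odd_permM addbb.
Qed.

Lemma cycle_permE k (i : 'I_5) : (k < 12)%N -> cycle_perm k i = cyc k i :> nat.
Proof.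
move=> k12; rewrite -[i](permKV (conj_perm k ^+ 2)%g); move: (_ i) => x.
rewrite permJ !permM /= !conj_permE // permE /=.
have /allP/(_ k) : all (fun k => all (fun x => conj5 k (conj5 k (x.+1 %% 5)) ==
    cyc k (conj5 k (conj5 k x))) (iota 0 5)) (iota 0 12).
  by vm_compute.
by rewrite mem_iota => /(_ k12)/allP/(_ x); rewrite mem_iota => /(_ (ltn_ord x))/eqP.
Qed.

Lemma cycle_perm_inj : {in iota 0 12 &, injective cycle_perm}.
Proof.
move=> k k' k_in k'_in /permP E; have k12 := k_in; have k'12 := k'_in.
rewrite !mem_iota /= in k12 k'12.
have /allP/(_ k k_in)/allP/(_ k' k'_in) : all (fun k => all (fun k' =>
    all (fun i => cyc k i == cyc k' i) (iota 0 5) ==> (k == k')) (iota 0 12)) (iota 0 12).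
  by vm_compute.
move/implyP => H; apply/eqP/H; apply/allP => i; rewrite mem_iota /= => i5.
by rewrite -[i]/(val (Ordinal i5)) -!cycle_permE // E.
Qed.

Lemma cycle_permV m : (m < 6)%N -> ((cycle_perm m)^-1)%g = cycle_perm (m + 6).
Proof.
move=> m6; apply/permP => i; apply: (@perm_inj _ (cycle_perm m)); rewrite permKV.
apply: val_inj; rewrite /= !cycle_permE ?(leq_trans m6) ?(ltn_add2r 6 m 6) //.
have /allP/(_ m) : all (fun m =>
    all (fun i => i == cyc m (cyc (m + 6) i)) (iota 0 5)) (iota 0 6).
  by vm_compute.
by rewrite mem_iota => /(_ m6)/allP/(_ i); rewrite mem_iota => /(_ (ltn_ord i))/eqP.
Qed.

(** The centralizer of a 5-cycle in A_5 has at least 5 of its 60 elements. *)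
Lemma card_five_cycles : (#|five_cycles| <= 12)%N.
Proof.
have cA : (rotation 5 \in 'Alt_('I_5))%g.
  have -> : rotation 5 = (rotation 5 ^+ 3 * rotation 5 ^+ 3)%g.
    by rewrite -expgD -[(3 + 3)%N]/(5 + 1)%N expgD rotation_exp mul1g.
  by rewrite Alt_even odd_permM addbb.
have := Lagrange (subsetIl 'Alt_('I_5) 'C[rotation 5])%g; rewrite index_cent1 => E.
have C5 : (5 <= #|'C_('Alt_('I_5))[rotation 5]%g|)%N.
  rewrite -[X in (X <= _)%N](@order_rotation 5) //; apply: dvdn_leq (cardG_gt0 _) (order_dvdG _).
  by rewrite inE cA cent1id.
have E60 : (2 * #|('Alt_('I_5))%g| = 120)%N by rewrite card_Alt card_ord.
rewrite leqNgt; apply/negP => lt; have := leq_mul C5 lt; rewrite E.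
by rewrite -(leq_pmul2l (isT : 0 < 2)%N) E60.
Qed.

Lemma five_cycles_cover c : c \in five_cycles -> exists2 k, (k < 12)%N & c = cycle_perm k.
Proof.
move=> cF; have [] := @uniq_min_size _ (map cycle_perm (iota 0 12)) (enum five_cycles).
- by rewrite map_inj_in_uniq ?iota_uniq //; apply: cycle_perm_inj.
- by move=> _ /mapP[k _ ->]; rewrite mem_enum cycle_perm_in.
- by rewrite size_map size_iota -cardE card_five_cycles.
move=> _ /(_ c); rewrite mem_enum cF => /mapP[k]; rewrite mem_iota => k12 ->.
by exists k.
Qed.

Lemma five_cyclesV c : c \in five_cycles -> (c^-1)%g \in five_cycles.
Proof.
case/five_cycles_cover => k k12 ->; have [k6|k6] := ltnP k 6.
  by rewrite cycle_permV // cycle_perm_in.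
have -> : k = (k - 6 + 6)%N by rewrite subnK.
by rewrite -cycle_permV ?invgK ?cycle_perm_in // ltn_subLR.
Qed.

End CycleTables.

Section Alt5Actions.
Local Notation K := [subg 'Alt_('I_5)].

Definition conj_act (x : 'S_5) (s : K) : 'S_5 := (x ^ sgval s)%g.
Lemma conj_act1 x : conj_act x 1%g = x. Proof. exact: conjg1. Qed.
Lemma conj_actM x s t : conj_act x (s * t)%g = conj_act (conj_act x s) t.
Proof. exact: conjgM. Qed.
Definition conj_action : {action K &-> 'S_5} := TotalAction conj_act1 conj_actM.

Lemma conj_actV x s : (conj_action x s)^-1%g = conj_action x^-1%g s.
Proof. by rewrite /= /conj_act conjVg. Qed.

Definition twisted_conj : {action timesC2 K &-> 'S_5} := twist invgK conj_actV.

Lemma twisted_conjE c g :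
  twisted_conj c g = if g \in leftfactor _ then (c ^ sgval g.1)%g
                     else ((c ^ sgval g.1)^-1)%g.
Proof. by []. Qed.

Lemma five_cyclesJ c (s : K) : c \in five_cycles -> (c ^ sgval s)%g \in five_cycles.
Proof.
by case/imsetP => t tA ->; rewrite -conjgM; apply: imset_f; rewrite groupM // subgP.
Qed.

Lemma five_cycles_stable c g : c \in five_cycles -> twisted_conj c g \in five_cycles.
Proof.
move=> cF; rewrite twisted_conjE; case: ifP => _; last apply: five_cyclesV;
  exact: five_cyclesJ.
Qed.

Definition five_cycle := {c | c \in five_cycles}.
Definition five_cycle_action : {action timesC2 K &-> five_cycle} :=
  sub_action five_cycles_stable.

Definition setconj_act (A : {set 'S_5}) (s : K) : {set 'S_5} := (A :^ sgval s)%g.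
Lemma setconj_act1 A : setconj_act A 1%g = A. Proof. exact: conjsg1. Qed.
Lemma setconj_actM A s t : setconj_act A (s * t)%g = setconj_act (setconj_act A s) t.
Proof. exact: conjsgM. Qed.
Definition setconj_action : {action K &-> {set 'S_5}} :=
  TotalAction setconj_act1 setconj_actM.

Definition pentagons : {set {set 'S_5}} := [set [set c; c^-1%g] | c in five_cycles].

Lemma pentagons_stable A g : A \in pentagons -> inflate setconj_action A g \in pentagons.
Proof.
case/imsetP => c cF ->; apply/imsetP; exists (c ^ sgval g.1)%g; first exact: five_cyclesJ.
by rewrite /= /inflate_act /= /setconj_act conjUg !conjg_set1 conjVg.
Qed.

Definition pentagon := {A | A \in pentagons}.
Definition pentagon_action : {action timesC2 K &-> pentagon} :=
  sub_action pentagons_stable.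

Definition setimg_act (B : {set 'I_5}) (s : K) : {set 'I_5} := sgval s @: B.
Lemma setimg_act1 B : setimg_act B 1%g = B.
Proof. by rewrite /setimg_act -[RHS]imset_id; apply: eq_imset => i; apply: perm1. Qed.
Lemma setimg_actM B s t : setimg_act B (s * t)%g = setimg_act (setimg_act B s) t.
Proof. by rewrite /setimg_act -imset_comp; apply: eq_imset => i; apply: permM. Qed.
Definition setimg_action : {action K &-> {set 'I_5}} :=
  TotalAction setimg_act1 setimg_actM.

Definition edges : {set {set 'I_5}} := [set [set ij.1; ij.2] | ij : 'I_5 * 'I_5].

Lemma edges_stable B g : B \in edges -> inflate setimg_action B g \in edges.
Proof.
case/imsetP => -[i j] _ ->; apply/imsetP.
exists (sgval g.1 i, sgval g.1 j) => //.
by rewrite /= /inflate_act /= /setimg_act imsetU1 imset_set1.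
Qed.

Definition edge := {B | B \in edges}.
Definition edge_action : {action timesC2 K &-> edge} := sub_action edges_stable.

Definition pair_or_pentagon := ('I_5 * 'I_5 + pentagon)%type.
Definition cycle_or_edge := (five_cycle + edge)%type.
Definition pair_or_pentagon_action : {action timesC2 K &-> pair_or_pentagon} :=
  sum_action (swap_action (subperm_action 'Alt_('I_5))) pentagon_action.
Definition cycle_or_edge_action : {action timesC2 K &-> cycle_or_edge} :=
  sum_action five_cycle_action edge_action.

Definition is_edge (B : {set 'I_5}) (A : {set 'S_5}) : bool :=
  [exists c in A, [exists i, B == [set i; c i]]].

(** The entries only use relations that conjugation preserves and that are
    symmetric under reversal, so the invariance is clear; Hcode is this matrix
    in coordinates. *)
Definition Hmat (l : cycle_or_edge) (i : pair_or_pentagon) : int :=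
  match l, i with
  | inl c, inl ij => (val c ij.1 == ij.2)%:R
  | inl c, inr A => if val c \in val A then 2 else -2
  | inr B, inl ij => ([set ij.1; ij.2] == val B)%:R
  | inr B, inr A => if is_edge (val B) (val A) then 1 else -2
  end.

Lemma pentagonV (A : pentagon) c : (c^-1%g \in val A) = (c \in val A).
Proof.
case: A => _ /= /imsetP[d _ ->]; rewrite !inE (inj_eq invg_inj) orbC.
by congr (_ || _); rewrite -(inj_eq invg_inj) invgK.
Qed.

Lemma is_edge_act B A s : is_edge (setimg_act B s) (setconj_act A s) = is_edge B A.
Proof.
have imp B' A' t : is_edge B' A' -> is_edge (setimg_act B' t) (setconj_act A' t).
  case/existsP => c /andP[cA /existsP[i /eqP Bi]]; apply/existsP.
  exists (c ^ sgval t)%g; rewrite memJ_conjg cA /=; apply/existsP; exists (sgval t i).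
  by rewrite permJ Bi /setimg_act imsetU1 imset_set1.
apply/idP/idP; last exact: imp.
by move/(imp _ _ s^-1%g); rewrite -setimg_actM -setconj_actM mulgV setimg_act1 setconj_act1.
Qed.

Lemma Hmat_inv l i g :
  Hmat (cycle_or_edge_action l g) (pair_or_pentagon_action i g) = Hmat l i.
Proof.
case: l i => [c|B] [ij|A] /=.
- rewrite /twist_act /=; case: ifP => gN /=; rewrite /conj_act /subperm_act.
    by rewrite permJ (inj_eq perm_inj).
  congr (nat_of_bool _)%:R; apply/eqP/eqP => [E|<-]; last by rewrite -(permJ (val c) (sgval g.1)) permK.
  by apply: (@perm_inj _ (sgval g.1)); rewrite -(permJ (val c) (sgval g.1)) -E permKV.
- rewrite /twist_act /inflate_act /=; congr (if _ then _ else _).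
  case: ifP => gN; rewrite ?(pentagonV (sub_act pentagons_stable A g)); exact: memJ_conjg.
- congr (nat_of_bool _)%:R; rewrite /inflate_act /= /setimg_act.
  rewrite -(inj_eq (imset_inj (@perm_inj _ (sgval g.1))) [set ij.1; _]) imsetU1 imset_set1.
  by rewrite /twist_act /=; case: ifP => _ //=; rewrite setUC.
by rewrite /inflate_act /= is_edge_act.
Qed.

End Alt5Actions.

(** * Comparison with the numerical matrix *)

Section Enumeration.
Variables (T : finType) (C : eqType) (d : C -> T) (s : seq C).
Hypotheses (s_uniq : uniq s) (d_inj : {in s &, injective d}).
Hypothesis d_cover : forall x, exists2 c, c \in s & x = d c.

Lemma sum_codes (F : T -> int) : \sum_x F x = sumz (F \o d) s.
Proof.
rewrite -sumzE -(big_map d xpredT F); apply: perm_big.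
apply: uniq_perm; rewrite ?index_enum_uniq ?map_inj_in_uniq //.
by move=> x; rewrite mem_index_enum; have [c cs ->] := d_cover x; rewrite map_f.
Qed.

Lemma decode : exists e : T -> C, [/\ forall x, e x \in s, forall x, d (e x) = x
  & {in s, forall c, e (d c) = c}].
Proof.
have [e eP] : exists e : T -> C, forall x, e x \in s /\ d (e x) = x.
  apply: (@fin_all_exists T (fun=> C) (fun x c => c \in s /\ d c = x)) => x.
  by have [c cs ->] := d_cover x; exists c.
exists e; split=> [x|x|c cs]; [by case: (eP x) | by case: (eP x) |].
by have [es ed] := eP (d c); apply: d_inj.
Qed.

End Enumeration.

Section Codes.

Lemma cycle_code (k : nat) (i j : 'I_5) :
  (k < 12)%N -> (cycle_perm k i == j) = (cyc k i == j).
Proof. by move=> k12; rewrite -val_eqE /= cycle_permE. Qed.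

Definition pentagon_code m : pentagon :=
  exist _ [set cycle_perm m; (cycle_perm m)^-1%g]
    (imset_f (fun c : 'S_5 => [set c; c^-1%g]) (cycle_perm_in m)).

Definition edge_code (a b : nat) : {set 'I_5} := [set inord a; inord b].

Lemma edge_code_in a b : edge_code a b \in edges.
Proof. by apply/imsetP; exists (inord a, inord b). Qed.

Definition of_codeI (c : codeI) : pair_or_pentagon :=
  match c with
  | inl ij => inl (inord ij.1, inord ij.2)
  | inr m => inr (pentagon_code m)
  end.

Definition of_codeL (c : codeL) : cycle_or_edge :=
  match c with
  | inl k => inl (exist _ (cycle_perm k) (cycle_perm_in k))
  | inr e => let ab := nth (0, 0)%N pair_table e in
      inr (exist _ (edge_code ab.1 ab.2) (edge_code_in ab.1 ab.2))
  end.

Lemma codesI_P c : c \in codesI -> match c with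
  | inl ij => (ij.1 < 5)%N /\ (ij.2 < 5)%N | inr m => (m < 6)%N end.
Proof.
rewrite mem_cat => /orP[|] /mapP[x xs ->].
  by case/allpairsP: xs => -[i j] []; rewrite !mem_iota => i5 j5 ->.
by move: xs; rewrite mem_iota.
Qed.

Lemma codesL_P c : c \in codesL -> match c with
  | inl k => (k < 12)%N | inr e => (e < 15)%N end.
Proof. by rewrite mem_cat => /orP[|] /mapP[x xs ->]; move: xs; rewrite mem_iota. Qed.

Lemma pair_table_P e : (e < 15)%N ->
  let ab := nth (0, 0)%N pair_table e in (ab.1 < 5)%N /\ (ab.2 < 5)%N.
Proof.
have /allP/(_ e) : all (fun e => let ab := nth (0, 0)%N pair_table e in
  (ab.1 < 5)%N && (ab.2 < 5)%N) (iota 0 15) by vm_compute.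
by rewrite mem_iota => H /H /andP.
Qed.

Lemma mem_pentagon k m : (k < 12)%N -> (m < 6)%N ->
  (cycle_perm k \in val (pentagon_code m)) = (k %% 6 == m)%N.
Proof.
move=> k12 m6; rewrite !inE cycle_permV // !(inj_in_eq cycle_perm_inj) ?mem_iota //=;
  rewrite ?(leq_trans m6) ?(ltn_add2r 6 m 6) //.
have /allP/(_ k) : all (fun k => all (fun m =>
   ((k == m) || (k == m + 6)) == (k %% 6 == m))%N (iota 0 6)) (iota 0 12) by vm_compute.
by rewrite mem_iota => /(_ k12)/allP/(_ m); rewrite mem_iota => /(_ m6)/eqP.
Qed.

Lemma edge_code_eq i j a b : (i < 5)%N -> (j < 5)%N -> (a < 5)%N -> (b < 5)%N ->
  (edge_code i j == edge_code a b) = (i == a) && (j == b) || (i == b) && (j == a).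
Proof.
by move=> *; rewrite /edge_code eq_set2 -!val_eqE /= !inordK.
Qed.

Lemma is_edge_code m a b : (m < 6)%N -> (a < 5)%N -> (b < 5)%N ->
  is_edge (edge_code a b) (val (pentagon_code m)) = edge_of m a b.
Proof.
move=> m6 a5 b5; have m12 : (m < 12)%N by apply: leq_trans m6 _.
have cE x y : (x < 5)%N -> (y < 5)%N ->
    (cycle_perm m (inord x) == inord y) = (cyc m x == y).
  by move=> x5 y5; rewrite cycle_code // !inordK.
rewrite /edge_of -!cE //; apply/existsP/orP => [[c /andP[]]|].
  rewrite !inE => /orP[]/eqP-> /existsP[i]; rewrite eq_set2 =>
    /orP[] /andP[/eqP-> /eqP->]; rewrite ?permKV eqxx; auto.
case=> [/eqP E|/eqP E]; exists (cycle_perm m); rewrite !inE eqxx /=; apply/existsP.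
  by exists (inord a); rewrite E.
by exists (inord b); rewrite E setUC.
Qed.

Lemma Hmat_code l c : l \in codesL -> c \in codesI ->
  Hmat (of_codeL l) (of_codeI c) = Hcode l c.
Proof.
move=> /codesL_P lP /codesI_P cP; case: l c lP cP => [k|e] [[i j]|m] /=.
- by move=> k12 [i5 j5]; rewrite cycle_code // !inordK.
- by move=> k12 m6; rewrite mem_pentagon.
- move=> /pair_table_P; case: (nth _ _ e) => a b /= [a5 b5] [i5 j5].
  by rewrite -[[set _; _]]/(edge_code i j) edge_code_eq.
move=> /pair_table_P; case: (nth _ _ e) => a b /= [a5 b5] m6.
by rewrite is_edge_code.
Qed.

Lemma of_codeI_inj : {in codesI &, injective of_codeI}.
Proof.
move=> c c' /codesI_P cP /codesI_P cP'; case: c c' cP cP' => [[i j]|m] [[i' j']|m'] //=.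
  move=> [i5 j5] [i'5 j'5] [E1 E2]; have := congr1 val E1; have := congr1 val E2.
  by rewrite /= !inordK // => -> ->.
move=> m6 m'6 [E]; congr inr.
have m12 : (m < 12)%N by apply: leq_trans m6 _.
have := mem_pentagon m12 m'6; rewrite modn_small //= -E !inE eqxx /=.
by move/esym/eqP.
Qed.

Lemma of_codeL_inj : {in codesL &, injective of_codeL}.
Proof.
move=> c c' /codesL_P cP /codesL_P cP'; case: c c' cP cP' => [k|e] [k'|e'] //=.
  by move=> k12 k'12 [/cycle_perm_inj]; rewrite !mem_iota => ->.
move=> e15 e'15 [/eqP E]; congr inr.
have [a5 b5] := pair_table_P e15; have [a'5 b'5] := pair_table_P e'15.
move: E; rewrite edge_code_eq // => E.
have /allP/(_ e) : all (fun e => all (fun e' =>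
   let ab := nth (0, 0)%N pair_table e in let ab' := nth (0, 0)%N pair_table e' in
   ((ab.1 == ab'.1) && (ab.2 == ab'.2) || (ab.1 == ab'.2) && (ab.2 == ab'.1))
     ==> (e == e')) (iota 0 15)) (iota 0 15) by vm_compute.
rewrite mem_iota => /(_ e15)/allP/(_ e'); rewrite mem_iota => /(_ e'15) /=.
by rewrite E => /eqP.
Qed.

Lemma of_codeI_cover x : exists2 c, c \in codesI & x = of_codeI c.
Proof.
case: x => [[i j]|[A AP]].
  exists (inl (val i, val j)); last by rewrite /= !inord_val.
  rewrite mem_cat map_f //; apply: (allpairs_f pair); rewrite mem_iota ltn_ord //.
have [c /five_cycles_cover[k k12 ->] AE] := imsetP AP.
exists (inr (k %% 6)%N).
  by rewrite mem_cat [X in _ || X]map_f ?orbT // mem_iota ltn_mod.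
congr inr; apply: val_inj; rewrite /= AE.
have [k6|k6] := ltnP k 6; first by rewrite modn_small.
have [m m6 ->] : exists2 m, (m < 6)%N & k = (m + 6)%N.
  by exists (k - 6)%N; rewrite ?subnK // ltn_subLR.
by rewrite modnDr modn_small // -cycle_permV // invgK setUC.
Qed.

Lemma of_codeL_cover x : exists2 c, c \in codesL & x = of_codeL c.
Proof.
case: x => [[c cP]|[B BP]].
  have [k k12 cE] := five_cycles_cover cP; exists (inl k).
    by rewrite mem_cat map_f // mem_iota.
  by congr inl; apply: val_inj.
have [[i j] _ BE] := imsetP BP.
have /allP/(_ i) : all (fun i => all (fun j => has (fun e =>
   let ab := nth (0, 0)%N pair_table e in
   (i == ab.1) && (j == ab.2) || (i == ab.2) && (j == ab.1)) (iota 0 15))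
   (iota 0 5)) (iota 0 5) by vm_compute.
rewrite mem_iota => /(_ (ltn_ord i))/allP/(_ j); rewrite mem_iota => /(_ (ltn_ord j)).
case/hasP => e; rewrite mem_iota => e15 ijE; exists (inr e).
  by rewrite mem_cat [X in _ || X]map_f ?orbT // mem_iota.
congr inr; apply: val_inj; rewrite /= BE /=; apply/eqP.
have [a5 b5] := pair_table_P e15.
by rewrite -[i]inord_val -[j]inord_val -/(edge_code i j) edge_code_eq.
Qed.

End Codes.

(** * The resolution for A_5 *)

Section Alt5.
Local Notation actA := (subperm_action 'Alt_('I_5)).
Local Notation J := (J_sign actA).

Definition embedI (x : {ffun 'I_5 * 'I_5 -> int}) : {ffun pair_or_pentagon -> int} :=
  [ffun i => match i with inl ij => x ij | inr _ => 0 end].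

Lemma embedIB : {morph embedI : x y / x - y}.
Proof. by move=> x y; apply/ffunP => -[ij|A]; rewrite !ffunE ?subrr. Qed.
HB.instance Definition _ := GRing.isZmodMorphism.Build
  {ffun 'I_5 * 'I_5 -> int} {ffun pair_or_pentagon -> int} embedI embedIB.

(** A cycle visits every point once, so the differences along it add up to
    zero; the row of an unordered pair is symmetric and the differences are
    antisymmetric. *)
Lemma rows_embed_diff l (a : {ffun 'I_5 -> int}) :
  rowsZ Hmat (embedI (jdiff (mkJ actA a))) l = 0.
Proof.
rewrite ffunE big_sumType /= [X in _ + X]big1 => [|A _]; last by rewrite ffunE mulr0.
rewrite addr0; under eq_bigr do rewrite ffunE jdiff_mk.
case: l => [c|B] /=.
  transitivity (\sum_i \sum_j (val c i == j)%:R * (a i - a j)).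
    by rewrite pair_bigA; apply: eq_bigr => -[].
  under eq_bigr => i _.
    rewrite (bigD1 (val c i)) //= eqxx mul1r big1 ?addr0; last first.
      by move=> j; rewrite eq_sym => /negPf ->; rewrite mul0r.
    over.
  by rewrite sumrB [X in X - _](reindex_inj (@perm_inj _ (val c))) subrr.
set S := \sum__ _; suff : S + S = 0.
  by move/eqP; rewrite -mulr2n mulrn_eq0 => /eqP.
rewrite {1}/S (reindex_inj (inv_inj (@swapK _))) -big_split big1 //= => -[i j] _ /=.
by rewrite setUC -mulrDr addrC addrA subrK subrr mulr0.
Qed.

Theorem J_sign_Alt5_quasi_permutation : quasi_permutation J.
Proof.
have sI : uniq codesI by vm_compute.
have sL : uniq codesL by vm_compute.
have [eI [eIs eIK eIE]] := decode of_codeI_inj of_codeI_cover.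
have [eL [eLs eLK eLE]] := decode of_codeL_inj of_codeL_cover.
pose v (l : cycle_or_edge) : {ffun pair_or_pentagon -> int} :=
  [ffun i => Rcode (eL l) (eI i)].
pose f := embedI \o @jdiff _ _ actA.
have sumI := sum_codes sI of_codeI_inj of_codeI_cover.
have sumL := sum_codes sL of_codeL_inj of_codeL_cover.
have HE l i : Hmat l i = Hcode (eL l) (eI i) by rewrite -Hmat_code // eLK eIK.
have eq_sumz (C : eqType) (F F' : C -> int) (s : seq C) :
    {in s, F =1 F'} -> sumz F s = sumz F' s.
  move=> FF; rewrite -!sumzE; exact: eq_big_seq.
apply: (@quasi_permutation_crit _ _ _ _ pair_or_pentagon_action
  cycle_or_edge_action f (rowsZ Hmat) (colsZ v)).
- move=> g u; rewrite /f /= jdiff_equivariant; apply/ffunP => -[ij|A];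
    by rewrite !ffunE.
- move=> u w /ffunP uw; apply: jdiff_inj; apply/ffunP => ij.
  by have := uw (inl ij); rewrite !ffunE.
- by apply: rowsZ_equivariant => l i g; apply: Hmat_inv.
- move=> u; have [a ->] := mkJ_surj u; apply/ffunP => l.
  by rewrite [RHS]ffunE; apply: rows_embed_diff.
- move=> x.
  pose D c d := \sum_l v l d * Hmat l c - (d == c)%:R.
  have DE c d : D c d = Dcode (eI c) (eI d).
    rewrite /D sumL; congr (_ - _%:R); last by rewrite (can_eq eIK).
    by apply: eq_sumz => l ls; rewrite /= ffunE HE eLE.
  (* A difference function a i - a j is recovered, up to a constant in a, from
     its values at j = 0. *)
  pose a : {ffun 'I_5 -> int} := [ffun i => \sum_c D c (inl (i, ord0)) * x c].
  exists (mkJ actA a); apply/ffunP => d.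
  rewrite /colsZ sum_ffunE.
  transitivity (\sum_c \sum_l v l d * Hmat l c * x c).
    rewrite exchange_big; apply: eq_bigr => l _ /=.
    rewrite ffun_mulrzE [rowsZ _ _ _]ffunE mulr_sumr.
    by apply: eq_bigr => c _; rewrite mulrA.
  transitivity (\sum_c ((d == c)%:R * x c + D c d * x c)).
    by apply: eq_bigr => c _; rewrite -mulr_suml -mulrDl /D addrC subrK.
  rewrite big_split /= ffunE; congr (_ + _).
    rewrite (bigD1 d) //= eqxx mul1r big1 ?addr0 // => c.
    by rewrite eq_sym => /negPf ->; rewrite mul0r.
  have chk c := allP (allP check_left_inverse (eI c) (eIs c)) (eI d) (eIs d).
  case: d chk => [[i j]|A] chk; rewrite ffunE /=; last first.
    rewrite big1 // => c _; rewrite DE; have := chk c.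
    have := eIK (inr A); case: (eI (inr A)) => [[p q]|m] //= _ /eqP ->.
    by rewrite mul0r.
  rewrite jdiff_mk !ffunE -sumrB; apply: eq_bigr => c _; rewrite -mulrBl !DE.
  have eI_inl (p q : 'I_5) : eI (inl (p, q)) = inl (val p, val q).
    rewrite -[RHS]eIE /= ?inord_val // mem_cat map_f //.
    by apply: (allpairs_f pair); rewrite mem_iota ltn_ord.
  by have := chk c; rewrite !eI_inl => /eqP ->.
move=> y; apply/ffunP => l; rewrite ffunE.
transitivity (\sum_l' \sum_i Hmat l i * v l' i * y l').
  rewrite exchange_big; apply: eq_bigr => i _ /=.
  rewrite /colsZ sum_ffunE mulr_sumr; apply: eq_bigr => l' _.
  by rewrite ffun_mulrzE mulrA.
have inner l' : \sum_i Hmat l i * v l' i * y l' = (l == l')%:R * y l'.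
  rewrite -mulr_suml; congr (_ * _); rewrite sumI.
  have /eqP := allP (allP check_right_inverse (eL l) (eLs l)) (eL l') (eLs l').
  rewrite (can_eq eLK) => <-; apply: eq_sumz => c cs.
  by rewrite /= ffunE HE eIE.
rewrite (eq_bigr _ (fun l' _ => inner l')) (bigD1 l) //= eqxx mul1r big1 ?addr0 //.
by move=> l'; rewrite eq_sym => /negPf ->; rewrite mul0r.
Qed.

End Alt5.

Theorem proposition5p16 :
  (forall p : nat, prime p -> (5 <= p)%N ->
     quasi_invertible (J_sign ('P : {action 'S_p &-> 'I_p})) /\
     ~ quasi_permutation (J_sign ('P : {action 'S_p &-> 'I_p}))) /\
  quasi_permutation (J_sign (subperm_action 'Alt_('I_5))).
Proof.
split; last exact: J_sign_Alt5_quasi_permutation.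
move=> p p_pr p5; split; first exact: J_sign_quasi_invertible.
exact: J_sign_not_quasi_permutation.
Qed.
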